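(* Let $0\le m<M<\infty$. For $x=(x_1,x_2,x_3)$ with $x_1^2\le x_2$, $x_2>0$, and $M-(M-m)\frac{x_1^2}{x_2}<x_3\le M$, put $$B(x_1,x_2,x_3;m,M)=\frac{(x_3-m)\,x_2}{\bigl[1-2a(M-m)\bigr]^2\bigl[1-4a(M-x_3)\bigr]}+m\,x_2,$$ where $a=a^-(x)$ is the unique negative solution of the cubic equation $$\frac{x_1^2}{x_2}=\left[\frac{1-2a(M-x_3)}{1-2a(M-m)}\right]^2\frac{1-4a(M-m)}{1-4a(M-x_3)}$$ (with $a^-(x)=0$ in the boundary case $x_1^2=x_2$). Then the lower Bellman function $\mathbf B_{\min}$ of the dyadic Carleson embedding theorem is given, for $x_2>0$, by $$\mathbf B_{\min}(x;m,M)=\begin{cases}B(x;m,M), & x_1^2\le x_2,\ M-(M-m)\frac{x_1^2}{x_2}<x_3\le M,\\[4pt] m\,x_2, & x_1^2\le x_2,\ m\le x_3\le M-(M-m)\frac{x_1^2}{x_2}.\end{cases}$$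
   Context: Let $I\subset\mathbb R$ be a bounded interval. $D(I)$ denotes the dyadic lattice of subintervals of $I$: $I$ itself, its left and right halves, the left and right halves of these, and so on. $|J|$ is the length of $J$, and $\langle\phi\rangle_J=\frac1{|J|}\int_J\phi(t)\,dt$. For $x=(x_1,x_2,x_3)$ with $x_1^2\le x_2$ and $m\le x_3\le M$, define $$\mathbf B_{\min}(x_1,x_2,x_3;m,M):=\inf\frac1{|I|}\Bigl\{\int_I|\phi(t)|^2\,d\mu(t)+\sum_{J\in D(I)}|\langle\phi\rangle_J|^2\alpha_J\Bigr\},$$ where the infimum is over all real-valued square-integrable functions $\phi$ on $I$, all non-negative measures $\mu$ on $I$ without atoms, and all families $\{\alpha_J\}_{J\in D(I)}$ of non-negative numbers satisfying $$\langle\phi\rangle_I=x_1,\qquad \langle\phi^2\rangle_I=x_2,\qquad \frac1{|I|}\Bigl(\mu(I)+\sum_{J\in D(I)}\alpha_J\Bigr)=x_3,$$ $$m|J|\le\mu(J)+\sum_{\ell\in D(J)}\alpha_\ell\le M|J|\quad\text{for all }J\in D(I).$$ The value does not depend on the choice of $I$. *)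

(* Defs.v *)
From HB Require Import structures.
From mathcomp Require Import all_boot all_order all_algebra.
From mathcomp Require Import all_classical all_reals all_analysis.

Set Implicit Arguments.
Unset Strict Implicit.
Unset Printing Implicit Defensive.

Import Order.TTheory GRing.Theory Num.Theory.
Import numFieldNormedType.Exports.

Local Open Scope classical_set_scope.
Local Open Scope ring_scope.

(* The common endpoint of two halves is put in the right one. This choice is
   immaterial: neither Lebesgue measure nor the atomless measures used below
   charge points. *)
Inductive dyadic (R : realType) (I : interval R) : set (interval R) :=
| dyadic_self : dyadic I I
| dyadic_left (bl br : bool) (c d : R) :
    dyadic I (Interval (BSide bl c) (BSide br d)) ->
    dyadic I (Interval (BSide bl c) (BLeft ((c + d) / 2)))
| dyadic_right (bl br : bool) (c d : R) :
    dyadic I (Interval (BSide bl c) (BSide br d)) ->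
    dyadic I (Interval (BLeft ((c + d) / 2)) (BSide br d)).

Definition len (R : realType) (J : interval R) : R :=
  fine (lebesgue_measure [set` J]).

Definition avg (R : realType) (phi : R -> R) (J : interval R) : R :=
  (len J)^-1 * Rintegral lebesgue_measure [set` J] phi.

Section Bellman.
Variables (R : realType) (I : interval R).

(* A measure on I is the restriction to I of a Borel measure on R: only the
   values of mu on subsets of I are ever used. Likewise alpha is a family
   indexed by [dyadic I], its values elsewhere being irrelevant. *)
Record admissible (x1 x2 x3 m M : R) (phi : R -> R)
    (mu : {measure set (measurableTypeR R) -> \bar R})
    (alpha : interval R -> R) : Prop := Admissible {
  adm_meas : measurable_fun [set` I] phi ;
  adm_sqr_int : lebesgue_measure.-integrable [set` I]
                  (fun t => (phi t ^+ 2)%:E) ;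
  adm_atomless : forall t, t \in I -> mu [set t] = 0%E ;
  adm_alpha_ge0 : forall J, dyadic I J -> 0 <= alpha J ;
  adm_avg : avg phi I = x1 ;
  adm_avg_sqr : avg (fun t => phi t ^+ 2) I = x2 ;
  adm_mass : (((len I)^-1)%:E *
    (mu [set` I] + \esum_(J in dyadic I) (alpha J)%:E) = x3%:E)%E ;
  adm_carleson : forall J, dyadic I J ->
    ((m * len J)%:E <= mu [set` J] + \esum_(l in dyadic J) (alpha l)%:E
                    <= (M * len J)%:E)%E
}.

Definition functional (phi : R -> R)
    (mu : {measure set (measurableTypeR R) -> \bar R})
    (alpha : interval R -> R) : \bar R :=
  (((len I)^-1)%:E *
   (\int[mu]_(t in [set` I]) (`|phi t| ^+ 2)%:E +
    \esum_(J in dyadic I) (`|avg phi J| ^+ 2 * alpha J)%:E))%E.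

Definition Bmin (x1 x2 x3 m M : R) : \bar R :=
  ereal_inf [set v | exists phi mu alpha,
    admissible x1 x2 x3 m M phi mu alpha /\ v = functional phi mu alpha].

End Bellman.

Section Formula.
Variables (R : realType) (x1 x2 x3 m M : R).

Definition cubic_eq (a : R) : Prop :=
  x1 ^+ 2 / x2 =
  ((1 - 2 * a * (M - x3)) / (1 - 2 * a * (M - m))) ^+ 2 *
  ((1 - 4 * a * (M - m)) / (1 - 4 * a * (M - x3))).

(* [xget] picks a negative solution; the default value 0 is irrelevant as soon
   as one exists. *)
Definition a_minus : R :=
  if x1 ^+ 2 == x2 then 0 else xget 0 [set a | a < 0 /\ cubic_eq a].

Definition Bformula : R :=
  (x3 - m) * x2 /
    ((1 - 2 * a_minus * (M - m)) ^+ 2 * (1 - 4 * a_minus * (M - x3)))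
  + m * x2.

End Formula.

(* Main.v *)
(** Lower bound.  Call [H] a subsolution if
      H((x + y) / 2 + (0, 0, a)) <= (H x + H y) / 2 + x_1^2 a   and   H x <= x_2 x_3,
    where x_1 on the right is the first coordinate of the point on the left.
    Descending the dyadic tree, [H x] is bounded by the functional plus an error
    which tends to 0 because mu <= M * Lebesgue.  For every b > 0 the function
      m x_2 + sup_y (y^2 (x_3 - m)
         - (M - m) (x_2 - 2 (1 + b) y x_1 + (1 + b)^2 y^2) / (b (1 + b)))
    is a subsolution: it is convex as a supremum of affine functions, and its
    x_3-derivative is the square of the optimal y, which is at most x_1^2.  The
    function B is the supremum over b of these, attained at b = -2 a (M - m).

    Upper bound.  Gluing competitors on the two halves of an interval makes the
    set of upper bounds convex, and putting a mass a on the whole interval moves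
    x_3 to x_3 + a at the price x_1^2 a.  For x_3 = M take
    (y, k y^2, M - (M - m) e) as a mixture, with a small weight e, of a point
    with x_3 = m and a rescaled copy (q y, k (q y)^2, M) of the point itself; the
    resulting inequality determines the value at x_3 = M when e tends to 0.
    The extremal segments from (u, u^2, m) to such a point give the other x_3. *)

Require Import Defs.
From HB Require Import structures.
From mathcomp Require Import all_boot all_order all_algebra.
From mathcomp Require Import all_classical all_reals all_analysis.
From mathcomp Require Import measurable_realfun ring lra.

Import Order.TTheory GRing.Theory Num.Theory.
Import numFieldNormedType.Exports.

Local Open Scope classical_set_scope.
Local Open Scope ring_scope.


(** * Dyadic intervals *)

Section DyadicIntervals.
Context {R : realType}.
Implicit Types (c d : R) (J K : interval R).

(** The flag [true] puts the cut just before the point: a left end is then closed and a right end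
    open. This is the shape that the constructors of [dyadic] match on. *)
Definition itv (bl : bool) c (br : bool) d := Interval (BSide bl c) (BSide br d).

Lemma dyadic_itv {bl c br d J} : c < d -> dyadic (itv bl c br d) J ->
  exists bl' c' br' d', [/\ J = itv bl' c' br' d', c <= c', c' < d' & d' <= d].
Proof.
move=> cd; elim=> [|b b' e f _ IH|b b' e f _ IH]; first by exists bl, c, br, d.
  case: IH => [?[?[?[? [[? ? ? ?] h1 h2 h3]]]]]; subst.
  by do 4!eexists; split; first reflexivity; lra.
case: IH => [?[?[?[? [[? ? ? ?] h1 h2 h3]]]]]; subst.
by do 4!eexists; split; first reflexivity; lra.
Qed.

Lemma dyadic_trans I J K : dyadic I J -> dyadic J K -> dyadic I K.
Proof.
move=> IJ; elim=> // b b' e f _ h; first exact: dyadic_left h.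
exact: dyadic_right h.
Qed.

(** The inductive definition grows the tree at its leaves. This equation peels it at the root, which
    is the form that gluing and descent use. *)
Lemma dyadic_itvE bl c br d :
  dyadic (itv bl c br d) = [set itv bl c br d] `|`
    (dyadic (itv bl c true ((c + d) / 2)) `|` dyadic (itv true ((c + d) / 2) br d)).
Proof.
apply/seteqP; split=> J.
  elim=> [|b b' e f _ [[? ? ? ?]|[h|h]]|b b' e f _ [[? ? ? ?]|[h|h]]]; subst.
  - by left.
  - by right; left; exact: dyadic_self.
  - by right; left; exact: dyadic_left h.
  - by right; right; exact: dyadic_left h.
  - by right; right; exact: dyadic_self.
  - by right; left; exact: dyadic_right h.
  - by right; right; exact: dyadic_right h.
case=> [->|[]]; first exact: dyadic_self.
  by apply: dyadic_trans; apply: dyadic_left; exact: dyadic_self.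
by apply: dyadic_trans; apply: dyadic_right; exact: dyadic_self.
Qed.

Section Halves.
Variables (bl br : bool) (c d : R).
Hypothesis cd : c < d.
Local Notation I := (itv bl c br d).
Local Notation Il := (itv bl c true ((c + d) / 2)).
Local Notation Ir := (itv true ((c + d) / 2) br d).

Lemma dyadic_leftN : ~ dyadic Il I.
Proof. by move: cd => cd'; case/dyadic_itv => [|? [? [? [? [[_ ? _ ?] ? ? ?]]]]]; lra. Qed.

Lemma dyadic_rightN : ~ dyadic Ir I.
Proof. by move: cd => cd'; case/dyadic_itv => [|? [? [? [? [[_ ? _ ?] ? ? ?]]]]]; lra. Qed.

Lemma dyadic_disj J : dyadic Il J -> dyadic Ir J -> False.
Proof.
move: cd => cd'; case/dyadic_itv => [|? [? [? [? [-> h1 h2 h3]]]]]; first lra.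
by case/dyadic_itv => [|? [? [? [? [[_ ? _ ?] ? ? ?]]]]]; lra.
Qed.

Lemma halvesE : [set` I] = [set` Il] `|` [set` Ir].
Proof. by move: cd => cd'; apply: itv_bndbnd_setU; [case: bl|case: br]; rewrite bnd_simp; lra. Qed.

Lemma halves_sub : [set` Il] `<=` [set` I] /\ [set` Ir] `<=` [set` I].
Proof. by rewrite halvesE; split => t ?; [left|right]. Qed.

Lemma halves_disj : [disjoint [set` Il] & [set` Ir]].
Proof.
apply/disj_set2P/seteqP; split=> // t [] /=.
by rewrite !in_itv /= => /andP[_ h1] /andP[h2 _]; move: (lt_le_trans h1 h2); rewrite ltxx.
Qed.

(** The three families are disjoint: comparing endpoints shows that the root lies in neither subtree
    and that the subtrees share no interval. *)
Lemma esum_dyadicE (f : interval R -> \bar R) :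
  (forall J, dyadic I J -> (0 <= f J)%E) ->
  (\esum_(J in dyadic I) f J =
    f I + (\esum_(J in dyadic Il) f J + \esum_(J in dyadic Ir) f J))%E.
Proof.
move=> f0; rewrite (esumID [set I])//; congr (_ + _)%E.
  rewrite (_ : _ `&` _ = [set I]) ?esum_set1//; first exact/f0/dyadic_self.
  by apply/seteqP; split=> J [] // -> ; split=> //; exact: dyadic_self.
rewrite (esumID (dyadic Il)); last by move=> J [] ? _; exact: f0.
congr (_ + _)%E; congr esum; apply/seteqP; split=> J.
- by case.
- move=> h; split=> //; split; last by move=> e; apply: dyadic_leftN; rewrite -e.
  by rewrite dyadic_itvE; right; left.
- by case=> [[]]; rewrite dyadic_itvE => -[//|[//|]].
- move=> h; split; last by move=> h2; exact: (dyadic_disj _ h2 h).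
  split; last by move=> e; apply: dyadic_rightN; rewrite -e.
  by rewrite dyadic_itvE; right; right.
Qed.

Lemma len_itv : len I = d - c.
Proof.
rewrite /len lebesgue_measure_itv/= lte_fin cd.
by rewrite -EFinD.
Qed.

End Halves.

Lemma dyadic_sub {bl c br d J} : c < d -> dyadic (itv bl c br d) J ->
  [set` J] `<=` [set` itv bl c br d].
Proof.
move=> cd; elim=> // b b' e f h; apply: subset_trans.
  have [? [? [? [? [[? ? ? ?] _ ef _]]]]] := dyadic_itv cd h; subst.
  exact: (halves_sub _ _ _ _ ef).1.
have [? [? [? [? [[? ? ? ?] _ ef _]]]]] := dyadic_itv cd h; subst.
exact: (halves_sub _ _ _ _ ef).2.
Qed.

Lemma measurable_itvR bl c br d :
  measurable ([set` itv bl c br d] : set (measurableTypeR R)).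
Proof. exact: measurable_itv. Qed.

Lemma lebesgue_itv bl c br d : c < d ->
  lebesgue_measure [set` itv bl c br d] = (len (itv bl c br d))%:E :> \bar R.
Proof. by move=> cd; rewrite len_itv// lebesgue_measure_itv/= lte_fin cd -EFinD. Qed.

End DyadicIntervals.

Arguments halvesE {R bl br c d}.
Arguments esum_dyadicE {R bl br c d}.

(** * Admissible triples *)

Section Admissible.
Context {R : realType}.
Implicit Types (c d : R) (J K : interval R) (f g phi : R -> R).
Local Notation leb := (@lebesgue_measure R).

Lemma len_gt0 bl c br d : c < d -> 0 < len (itv bl c br d).
Proof. by move=> cd; rewrite len_itv// subr_gt0. Qed.

Lemma len_halves bl br c d : c < d ->
  len (itv bl c true ((c + d) / 2)) = len (itv bl c br d) / 2 /\
  len (itv true ((c + d) / 2) br d) = len (itv bl c br d) / 2.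
Proof. by move=> cd; rewrite !len_itv; try lra; split; lra. Qed.

Lemma avg_halves bl c br d f : c < d ->
  leb.-integrable [set` itv bl c br d] (EFin \o f) ->
  avg f (itv bl c br d) =
    (avg f (itv bl c true ((c + d) / 2)) + avg f (itv true ((c + d) / 2) br d)) / 2.
Proof.
move=> cd fi; rewrite /avg (halvesE cd) Rintegral_setU//.
- have [hl hr] := len_halves bl br _ _ cd.
  rewrite hl hr; field; exact/lt0r_neq0/len_gt0.
- by rewrite -halvesE.
- exact: halves_disj.
Qed.

Lemma eq_avg f g J : {in J, f =1 g} -> avg f J = avg g J.
Proof.
move=> fg; congr (_ * _); apply: eq_Rintegral => t.
by rewrite inE/=; exact: fg.
Qed.

Lemma avg_cst (u : R) bl c br d : c < d -> avg (fun=> u) (itv bl c br d) = u.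
Proof.
move=> cd; rewrite /avg Rintegral_cst//= lebesgue_itv//=.
by rewrite mulrCA mulVf ?mulr1// gt_eqF// len_gt0.
Qed.

Lemma leb_itv_fin bl c br d : (leb [set` itv bl c br d] < +oo)%E.
Proof. by rewrite lebesgue_measure_itv; case: ifP => // _; rewrite /= -EFinD ltry. Qed.

Lemma integrable_cst_itv (u : R) bl c br d :
  leb.-integrable [set` itv bl c br d] (fun=> u%:E).
Proof.
apply/integrableP; split; first exact: measurable_cst.
rewrite integral_cst//=; apply: lte_mul_pinfty => //.
exact: leb_itv_fin.
Qed.

(** On a bounded interval [1 + phi ^+ 2] is integrable, and it dominates the modulus of [phi]
    because the squares of [phi t - 1] and [phi t + 1] are non-negative. *)
Lemma sqr_integrable phi bl c br d :
  measurable_fun [set` itv bl c br d] phi ->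
  leb.-integrable [set` itv bl c br d] (fun t => (phi t ^+ 2)%:E) ->
  leb.-integrable [set` itv bl c br d] (EFin \o phi).
Proof.
move=> mphi i2.
have ig : leb.-integrable [set` itv bl c br d] (fun t => 1%:E + (phi t ^+ 2)%:E)%E.
  by apply: integrableD => //; exact: integrable_cst_itv.
apply: le_integrable ig => //; first exact/measurable_EFinP.
move=> t _ /=; rewrite lee_fin [leRHS]ger0_norm; last by rewrite addr_ge0// sqr_ge0.
rewrite ler_norml; have h1 := sqr_ge0 (phi t - 1); have h2 := sqr_ge0 (phi t + 1).
by apply/andP; split; nra.
Qed.

Lemma integrable_halves {h : R -> \bar R} {bl c br d} : c < d ->
  leb.-integrable [set` itv bl c true ((c + d) / 2)] h ->
  leb.-integrable [set` itv true ((c + d) / 2) br d] h ->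
  leb.-integrable [set` itv bl c br d] h.
Proof.
move=> cd /integrableP[ml il] /integrableP[mr ir].
have mh : measurable_fun [set` itv bl c br d] h.
  by rewrite (halvesE cd); apply/measurable_funU.
apply/integrableP; split=> //; rewrite (halvesE cd) ge0_integral_setU//.
- exact: lte_add_pinfty.
- rewrite -halvesE//; exact: measurableT_comp.
- exact: halves_disj.
Qed.

Section Facts.
Context {bl br : bool} {c d x1 x2 x3 m M : R} {phi : R -> R}.
Context {mu : {measure set (measurableTypeR R) -> \bar R}} {al : interval R -> R}.
Local Notation I := (itv bl c br d).
Hypotheses (cd : c < d) (adm : admissible I x1 x2 x3 m M phi mu al).

(** An infinite total would stay infinite after division by the length, so the mass condition also
    gives finiteness. *)
Lemma adm_massE : (mu [set` I] + \esum_(J in dyadic I) (al J)%:E = (x3 * len I)%:E)%E.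
Proof.
have l0 := len_gt0 bl _ br _ cd.
have := adm_mass adm; case: (_ + _)%E => [r| |].
- by rewrite -EFinM => -[<-]; congr (_%:E); field; exact: lt0r_neq0.
- by rewrite gt0_muley// lte_fin invr_gt0.
- by rewrite gt0_muleNy// lte_fin invr_gt0.
Qed.

Lemma adm_integrable : leb.-integrable [set` I] (EFin \o phi).
Proof. exact: sqr_integrable (adm_meas adm) (adm_sqr_int adm). Qed.

End Facts.

Lemma functional_leP {bl c br d phi}
    {mu : {measure set (measurableTypeR R) -> \bar R}} {al} {v : R} : c < d ->
  (functional (itv bl c br d) phi mu al <= v%:E)%E <->
  (\int[mu]_(t in [set` itv bl c br d]) (`|phi t| ^+ 2)%:E +
   \esum_(J in dyadic (itv bl c br d)) (`|avg phi J| ^+ 2 * al J)%:E <=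
   (len (itv bl c br d) * v)%:E)%E.
Proof.
move=> cd; have l0 := len_gt0 bl _ br _ cd.
rewrite /functional lee_pdivrMl// EFinM; by split.
Qed.

End Admissible.

(** * Gluing competitors *)

Section Constructions.
Context {R : realType}.
Implicit Types (c d : R) (J K : interval R) (phi : R -> R).
Local Notation leb := (@lebesgue_measure R).

(** The competitor is the constant [u] with [x3] times Lebesgue measure and no weights; its mass per
    unit length is [x3] on every subinterval. *)
Lemma Bmin_cst (u x3 m M : R) bl c br d : c < d -> 0 <= m -> m <= x3 <= M ->
  (Bmin (itv bl c br d) u (u ^+ 2) x3 m M <= (u ^+ 2 * x3)%:E)%E.
Proof.
move=> cd m0 /andP[mx xM].
have x30 : 0 <= x3 by exact: le_trans mx.
pose mu : {measure set (measurableTypeR R) -> \bar R} := mscale (NngNum x30) leb.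
have muE b a b' e : a < e -> mu [set` itv b a b' e] = (x3 * len (itv b a b' e))%:E.
  move=> ae; rewrite [LHS](_ : _ = (x3%:E * leb [set` itv b a b' e])%E); last by [].
  by rewrite lebesgue_itv// -EFinM.
have l0 := len_gt0 bl _ br _ cd.
apply: ereal_inf_lbound; exists (fun=> u), mu, (fun=> 0).
have e0 J (f : interval R -> R) : (\esum_(l in dyadic J) (f l * 0)%:E = 0)%E.
  by apply: esum1 => l _; rewrite mulr0.
have e1 J : (\esum_(l in dyadic J) (0 : R)%:E = 0)%E by apply: esum1.
split.
- split=> //.
  + exact: integrable_cst_itv.
  + by move=> t _; rewrite /= /mscale/= lebesgue_measure_set1 mule0.
  + by rewrite avg_cst.
  + by rewrite avg_cst.
  + by rewrite e1 adde0 muE// -EFinM; congr _%:E; field; exact: lt0r_neq0.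
  + move=> J /(dyadic_itv cd)[b [a [b' [e [-> _ ae _]]]]].
    have le0 := len_gt0 b _ b' _ ae.
    by rewrite e1 adde0 muE// !lee_fin !ler_wpM2r// ltW.
- rewrite /functional e0 adde0 integral_cst//=; rewrite muE// -!EFinM real_normK ?num_real//.
  by congr _%:E; field; exact: lt0r_neq0.
Qed.

Section Glue.
Variables (bl br : bool) (c d m M : R).
Local Notation I := (itv bl c br d).
Local Notation Il := (itv bl c true ((c + d) / 2)).
Local Notation Ir := (itv true ((c + d) / 2) br d).
Hypothesis cd : c < d.
Variables (y1 y2 y3 z1 z2 z3 a : R) (f g : R -> R).
Variables (mu nu : {measure set (measurableTypeR R) -> \bar R}) (al be : interval R -> R).
Hypotheses (adml : admissible Il y1 y2 y3 m M f mu al).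
Hypotheses (admr : admissible Ir z1 z2 z3 m M g nu be).
Hypotheses (a0 : 0 <= a) (aM : (y3 + z3) / 2 + a <= M) (ma : m <= (y3 + z3) / 2 + a).

Let cm : c < (c + d) / 2. Proof. by move: cd => ?; lra. Qed.
Let md : (c + d) / 2 < d. Proof. by move: cd => ?; lra. Qed.

Definition glue_fun t := if t < (c + d) / 2 then f t else g t.

(** Both measures live on the whole line and may charge the other half, hence the restrictions. *)
Definition glue_measure : {measure set (measurableTypeR R) -> \bar R} :=
  measure_add (mrestr mu (measurable_itvR bl c true ((c + d) / 2)))
              (mrestr nu (measurable_itvR true ((c + d) / 2) br d)).

(** The root receives [a * len I], so that [a] is the increase of the mass per unit length. *)
Definition glue_weight J : R :=
  if J == I then a * len I else if `[< dyadic Il J >] then al J else be J.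

Lemma glue_funl : {in Il, glue_fun =1 f}.
Proof. by move=> t; rewrite /glue_fun in_itv/= => /andP[_ ->]. Qed.

Lemma glue_funr : {in Ir, glue_fun =1 g}.
Proof. by move=> t; rewrite /glue_fun in_itv/= => /andP[+ _]; rewrite leNgt => /negbTE ->. Qed.

Lemma glue_weightl J : dyadic Il J -> glue_weight J = al J.
Proof.
rewrite /glue_weight => h; case: eqP => [e|_]; last by rewrite asboolT.
by exfalso; apply: (dyadic_leftN bl br _ _ cd); rewrite -e.
Qed.

Lemma glue_weightr J : dyadic Ir J -> glue_weight J = be J.
Proof.
rewrite /glue_weight => h; case: eqP => [e|_]; last first.
  by rewrite asboolF// => h'; exact: (dyadic_disj bl br _ _ cd J h' h).
by exfalso; apply: (dyadic_rightN bl br _ _ cd); rewrite -e.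
Qed.

Lemma glue_weightT : glue_weight I = a * len I.
Proof. by rewrite /glue_weight eqxx. Qed.

Lemma glue_measureE (A : set (measurableTypeR R)) :
  glue_measure A = (mu (A `&` [set` Il]) + nu (A `&` [set` Ir]))%E.
Proof. exact: measure_addE. Qed.

Lemma glue_measurel (A : set (measurableTypeR R)) : A `<=` [set` Il] -> glue_measure A = mu A.
Proof.
move=> AI; rewrite glue_measureE.
rewrite (setIidl AI) (_ : A `&` _ = set0) ?measure0 ?adde0//.
apply/seteqP; split=> // t [At rt]; have := halves_disj bl br c d.
by move=> /disj_set2P/seteqP[+ _] => /(_ t); apply; split=> //; exact: AI.
Qed.

Lemma glue_measurer (A : set (measurableTypeR R)) : A `<=` [set` Ir] -> glue_measure A = nu A.
Proof.
move=> AI; rewrite glue_measureE.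
rewrite (setIidl AI) (_ : A `&` _ = set0) ?measure0 ?add0e//.
apply/seteqP; split=> // t [At rt]; have := halves_disj bl br c d.
by move=> /disj_set2P/seteqP[+ _] => /(_ t); apply; split=> //; exact: AI.
Qed.

Lemma glue_measureT : glue_measure [set` I] = (mu [set` Il] + nu [set` Ir])%E.
Proof. by rewrite glue_measureE !setIidr//; case: (halves_sub bl br _ _ cd). Qed.

Lemma esum_glue (q : interval R -> R -> \bar R) J :
  (dyadic Il J -> \esum_(l in dyadic J) q l (glue_weight l) =
                 \esum_(l in dyadic J) q l (al l)) /\
  (dyadic Ir J -> \esum_(l in dyadic J) q l (glue_weight l) =
                 \esum_(l in dyadic J) q l (be l)).
Proof.
split=> h; apply: eq_esum => l Jl.
  by rewrite glue_weightl//; exact: dyadic_trans Jl.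
by rewrite glue_weightr//; exact: dyadic_trans Jl.
Qed.

Lemma glue_weight_ge0 J : dyadic I J -> 0 <= glue_weight J.
Proof.
rewrite dyadic_itvE => -[->|[h|h]].
- by rewrite glue_weightT mulr_ge0// ltW// len_gt0.
- by rewrite glue_weightl//; exact: (adm_alpha_ge0 adml).
- by rewrite glue_weightr//; exact: (adm_alpha_ge0 admr).
Qed.

Lemma glue_mass : (glue_measure [set` I] + \esum_(J in dyadic I) (glue_weight J)%:E =
  (((y3 + z3) / 2 + a) * len I)%:E)%E.
Proof.
rewrite esum_dyadicE//; last first.
  by move=> J h; rewrite lee_fin glue_weight_ge0.
have [h1 _] := esum_glue (fun _ => EFin) Il; have [_ h2] := esum_glue (fun _ => EFin) Ir.
rewrite h1 ?h2; try exact: dyadic_self.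
rewrite glue_measureT glue_weightT addeCA addeACA.
rewrite (adm_massE cm adml) (adm_massE md admr).
have [-> ->] := len_halves bl br _ _ cd.
by rewrite -!EFinD; congr _%:E; field.
Qed.

Let glue_measurable (q : R -> R) :
  measurable_fun [set` Il] (q \o f) -> measurable_fun [set` Ir] (q \o g) ->
  measurable_fun [set` I] (q \o glue_fun).
Proof.
move=> mf mg; rewrite (halvesE cd); apply/measurable_funU => //; split.
  by apply: eq_measurable_fun mf => t; rewrite inE/= => h; rewrite glue_funl.
by apply: eq_measurable_fun mg => t; rewrite inE/= => h; rewrite glue_funr.
Qed.

Let glue_integrable (q : R -> R) :
  leb.-integrable [set` Il] (EFin \o (q \o f)) ->
  leb.-integrable [set` Ir] (EFin \o (q \o g)) ->
  leb.-integrable [set` I] (EFin \o (q \o glue_fun)).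
Proof.
move=> hf hg; apply: (integrable_halves cd).
  by apply: eq_integrable hf => // t; rewrite inE/= => h; rewrite glue_funl.
by apply: eq_integrable hg => // t; rewrite inE/= => h; rewrite glue_funr.
Qed.

Let glue_avg (q : R -> R) :
  leb.-integrable [set` Il] (EFin \o (q \o f)) ->
  leb.-integrable [set` Ir] (EFin \o (q \o g)) ->
  avg (q \o glue_fun) I = (avg (q \o f) Il + avg (q \o g) Ir) / 2.
Proof.
move=> hf hg; rewrite (avg_halves _ _ _ _ _ cd); last exact: glue_integrable.
by congr ((_ + _) / 2); apply: eq_avg => t h; congr (q _); [exact: glue_funl|exact: glue_funr].
Qed.

Lemma glue_admissible :
  admissible I ((y1 + z1) / 2) ((y2 + z2) / 2) ((y3 + z3) / 2 + a) m M
    glue_fun glue_measure glue_weight.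
Proof.
have fi := adm_integrable adml.
have gi := adm_integrable admr.
have f2 := adm_sqr_int adml; have g2 := adm_sqr_int admr.
split.
- by apply: (glue_measurable id); [exact: (adm_meas adml)|exact: (adm_meas admr)].
- exact: (glue_integrable (fun x => x ^+ 2)).
- move=> t tI; have : ([set` Il] `|` [set` Ir]) t by rewrite -(halvesE cd).
  move=> [h|h].
    rewrite glue_measurel; first exact: (adm_atomless adml).
    by move=> _ ->.
  rewrite glue_measurer; first exact: (adm_atomless admr).
  by move=> _ ->.
- exact: glue_weight_ge0.
- by rewrite (glue_avg id)// -(adm_avg adml) -(adm_avg admr).
- by rewrite (glue_avg (fun x => x ^+ 2))// -(adm_avg_sqr adml) -(adm_avg_sqr admr).
- rewrite glue_mass -EFinM; congr _%:E; field; exact/lt0r_neq0/len_gt0.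
- move=> J; rewrite dyadic_itvE => -[->|[h|h]].
  + by rewrite glue_mass !lee_fin !ler_wpM2r// ltW// len_gt0.
  + rewrite (esum_glue (fun _ => EFin) J).1// glue_measurel; first exact: (adm_carleson adml).
    exact: (dyadic_sub cm).
  + rewrite (esum_glue (fun _ => EFin) J).2// glue_measurer; first exact: (adm_carleson admr).
    exact: (dyadic_sub md).
Qed.

Lemma avg_gluel J : dyadic Il J -> avg glue_fun J = avg f J.
Proof.
move=> h; apply: eq_avg => t /(dyadic_sub cm h); exact: glue_funl.
Qed.

Lemma avg_gluer J : dyadic Ir J -> avg glue_fun J = avg g J.
Proof.
move=> h; apply: eq_avg => t /(dyadic_sub md h); exact: glue_funr.
Qed.

(** Each half has half the length, so [v] and [w] are averaged; the mass at the root is charged with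
    the square of the mean over the whole interval. *)
Lemma glue_functional (v w : R) :
  (functional Il f mu al <= v%:E -> functional Ir g nu be <= w%:E ->
   functional I glue_fun glue_measure glue_weight <=
     ((v + w) / 2 + ((y1 + z1) / 2) ^+ 2 * a)%:E)%E.
Proof.
move=> /(functional_leP cm) hl /(functional_leP md) hr.
apply/(functional_leP cd).
rewrite esum_dyadicE//; last first.
  by move=> J h; rewrite lee_fin mulr_ge0// ?exprn_ge0// glue_weight_ge0.
rewrite glue_weightT (adm_avg glue_admissible) real_normK ?num_real//.
have -> : (\int[glue_measure]_(t in [set` I]) (`|glue_fun t| ^+ 2)%:E =
    \int[mu]_(t in [set` Il]) (`|f t| ^+ 2)%:E +
     \int[nu]_(t in [set` Ir]) (`|g t| ^+ 2)%:E)%E.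
  have mglue : measurable_fun [set` I] (fun t => (`|glue_fun t| ^+ 2)%:E).
    apply/measurable_EFinP/measurable_funX.
    by apply: measurableT_comp => //; exact: (adm_meas glue_admissible).
  rewrite (halvesE cd) in mglue *.
  rewrite ge0_integral_setU//; last exact: halves_disj.
  congr (_ + _)%E.
    rewrite (eq_measure_integral mu) => [|A _]; last exact: glue_measurel.
    by apply: eq_integral => t; rewrite inE/= => h; rewrite glue_funl.
  rewrite (eq_measure_integral nu) => [|A _]; last exact: glue_measurer.
  by apply: eq_integral => t; rewrite inE/= => h; rewrite glue_funr.
have -> : (\esum_(J in dyadic Il) (`|avg glue_fun J| ^+ 2 * glue_weight J)%:E =
           \esum_(J in dyadic Il) (`|avg f J| ^+ 2 * al J)%:E)%E.
  by apply: eq_esum => J h; rewrite avg_gluel// glue_weightl.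
have -> : (\esum_(J in dyadic Ir) (`|avg glue_fun J| ^+ 2 * glue_weight J)%:E =
           \esum_(J in dyadic Ir) (`|avg g J| ^+ 2 * be J)%:E)%E.
  by apply: eq_esum => J h; rewrite avg_gluer// glue_weightr.
rewrite addeCA addeACA.
apply: (le_trans (leeD2l _ (leeD hl hr))).
have [-> ->] := len_halves bl br _ _ cd.
by rewrite -!EFinD lee_fin le_eqVlt; apply/orP; left; apply/eqP; field.
Qed.

End Glue.

Arguments glue_admissible {bl br c d m M} cd {y1 y2 y3 z1 z2 z3 a f g mu nu al be}.
Arguments glue_functional {bl br c d m M} cd {y1 y2 y3 z1 z2 z3 a f g mu nu al be}.

(** Nearly optimal competitors are chosen on the two halves and glued. The two bounds are thus used
    on intervals other than the one in the conclusion, which is why they are assumed on all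
    intervals. *)
Lemma Bmin_glue (y1 y2 y3 z1 z2 z3 a v w m M : R) :
  0 <= m -> m <= y3 -> m <= z3 -> 0 <= a -> (y3 + z3) / 2 + a <= M ->
  (forall bl c br d, c < d -> (Bmin (itv bl c br d) y1 y2 y3 m M <= v%:E)%E) ->
  (forall bl c br d, c < d -> (Bmin (itv bl c br d) z1 z2 z3 m M <= w%:E)%E) ->
  forall bl c br d, c < d ->
   (Bmin (itv bl c br d) ((y1 + z1) / 2) ((y2 + z2) / 2) ((y3 + z3) / 2 + a) m M
    <= ((v + w) / 2 + ((y1 + z1) / 2) ^+ 2 * a)%:E)%E.
Proof.
move=> m0 my mz a0 aM hy hz bl c br d cd.
apply/lee_addgt0Pr => e e0.
have cm : c < (c + d) / 2 by lra.
have md : (c + d) / 2 < d by lra.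
have adh b1 c1 b2 d1 x1 x2 x3 q : (Bmin (itv b1 c1 b2 d1) x1 x2 x3 m M <= q%:E)%E ->
   exists f mu al, admissible (itv b1 c1 b2 d1) x1 x2 x3 m M f mu al /\
     (functional (itv b1 c1 b2 d1) f mu al <= (q + e)%:E)%E.
  move=> h; have : (Bmin (itv b1 c1 b2 d1) x1 x2 x3 m M < (q + e)%:E)%E.
    by apply: le_lt_trans h _; rewrite lte_fin ltrDl.
  by move=> /ereal_inf_lt[_ [f [mu [al [? ->]]]] /ltW h']; exists f, mu, al.
have [f [mu [al [admf ff]]]] := adh _ _ _ _ _ _ _ _ (hy bl _ true _ cm).
have [g [nu [be [admg fg]]]] := adh _ _ _ _ _ _ _ _ (hz true _ br _ md).
have ma : m <= (y3 + z3) / 2 + a by lra.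
have := glue_functional cd admf admg a0 aM ma _ _ ff fg.
move=> h; apply: le_trans (ereal_inf_lbound _) (le_trans h _).
  by do 3!eexists; split; [exact: (glue_admissible cd admf admg)|].
by rewrite -EFinD lee_fin; lra.
Qed.

End Constructions.

(** * The upper bound *)

Lemma conv_itv {F : realFieldType} {t lo hi a b : F} :
  0 <= t <= 1 -> lo <= a <= hi -> lo <= b <= hi -> lo <= (1 - t) * a + t * b <= hi.
Proof.
move=> /andP[t0 t1] /andP[la ah] /andP[lb bh].
have s0 : 0 <= 1 - t by lra.
have := mulr_ge0 s0 (_ : 0 <= a - lo); have := mulr_ge0 s0 (_ : 0 <= hi - a).
have := mulr_ge0 t0 (_ : 0 <= b - lo); have := mulr_ge0 t0 (_ : 0 <= hi - b).
rewrite !subr_ge0 => /(_ bh) h1 /(_ lb) h2 /(_ ah) h3 /(_ la) h4.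
by apply/andP; split; lra.
Qed.

Lemma geometric_small (F : realType) (q C e : F) : 0 <= q < 1 -> 0 < e ->
  exists n : nat, q ^+ n * C <= e.
Proof.
move=> /andP[q0 q1] e0.
have qn : (fun n => q ^+ n * C) @ \oo --> (0 : F).
  by rewrite -(mul0r C); apply: cvgMl; apply: cvg_expr; rewrite ger0_norm.
have [n _ /(_ n (leqnn n))/ltW hn] := cvgr_lt _ qn e e0.
by exists n.
Qed.

Section UpperBound.
Context {R : realType}.
Variables m M : R.
Hypotheses (m0 : 0 <= m) (mM : m < M).

Definition Bmin_le x1 x2 x3 v := forall bl c br d, c < d ->
  (Bmin (itv bl c br d) x1 x2 x3 m M <= v%:E)%E.

Lemma Bmin_le_lim x1 x2 x3 v :
  (forall e, 0 < e -> Bmin_le x1 x2 x3 (v + e)) -> Bmin_le x1 x2 x3 v.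
Proof.
move=> h bl c br d cd; apply/lee_addgt0Pr => e e0.
by rewrite -EFinD; exact: h.
Qed.

Lemma Bmin_le_mono x1 x2 x3 v w : v <= w -> Bmin_le x1 x2 x3 v -> Bmin_le x1 x2 x3 w.
Proof. by move=> vw h bl c br d cd; apply: le_trans (h _ _ _ _ cd) _; rewrite lee_fin. Qed.

Lemma Bmin_le_mid {y1 y2 y3 z1 z2 z3 v w} : m <= y3 <= M -> m <= z3 <= M ->
  Bmin_le y1 y2 y3 v -> Bmin_le z1 z2 z3 w ->
  Bmin_le ((y1 + z1) / 2) ((y2 + z2) / 2) ((y3 + z3) / 2) ((v + w) / 2).
Proof.
move=> /andP[my yM] /andP[mz zM] hy hz bl c br d cd.
have aM : (y3 + z3) / 2 + 0 <= M by lra.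
have := Bmin_glue _ _ _ _ _ _ 0 v w m M m0 my mz (lexx _) aM hy hz bl c br d cd.
by rewrite mulr0 !addr0.
Qed.

(** The point is glued with itself: the midpoint does not move, and only the mass at the root is
    added. *)
Lemma Bmin_le_jump {x1 x2 x3 v a} : 0 <= a -> m <= x3 -> x3 + a <= M ->
  Bmin_le x1 x2 x3 v -> Bmin_le x1 x2 (x3 + a) (v + x1 ^+ 2 * a).
Proof.
move=> a0 mx xM h bl c br d cd.
have aM : (x3 + x3) / 2 + a <= M by lra.
have := Bmin_glue _ _ _ _ _ _ a v v m M m0 mx mx a0 aM h h bl c br d cd.
have mid (z : R) : (z + z) / 2 = z by field.
by rewrite !mid.
Qed.

(** Gluing the constants [x1 - s] and [x1 + s], with [s] the standard deviation, gives a step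
    function with the right first two moments; the mass has density [x3]. *)
Lemma Bmin_le_crude x1 x2 x3 : x1 ^+ 2 <= x2 -> m <= x3 <= M -> Bmin_le x1 x2 x3 (x2 * x3).
Proof.
move=> h12 hx3; pose s := Num.sqrt (x2 - x1 ^+ 2).
have s2 : s ^+ 2 = x2 - x1 ^+ 2 by rewrite sqr_sqrtr// subr_ge0.
have cst u : Bmin_le u (u ^+ 2) x3 (u ^+ 2 * x3).
  by move=> bl c br d cd; exact: Bmin_cst.
have := Bmin_le_mid hx3 hx3 (cst (x1 - s)) (cst (x1 + s)).
have -> : x2 = x1 ^+ 2 + s ^+ 2 by rewrite s2; lra.
by congr Bmin_le; field.
Qed.

(** Midpoint convexity is iterated along the binary expansion of [t]. The crude bound starts the
    induction with an error [C], and each midpoint step halves the error. *)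
Lemma Bmin_le_conv {y1 y2 y3 z1 z2 z3 v w t} :
  y1 ^+ 2 <= y2 -> z1 ^+ 2 <= z2 -> m <= y3 <= M -> m <= z3 <= M ->
  Bmin_le y1 y2 y3 v -> Bmin_le z1 z2 z3 w -> 0 <= t <= 1 ->
  Bmin_le ((1 - t) * y1 + t * z1) ((1 - t) * y2 + t * z2) ((1 - t) * y3 + t * z3)
    ((1 - t) * v + t * w).
Proof.
move=> hy hz /[dup] Y3 /andP[my yM] /[dup] Z3 /andP[mz zM] Py Pz ht.
pose C := `|v| + `|w| + (y2 + z2) * M.
have M0 : 0 <= M by exact: le_trans (ltW mM).
have y20 : 0 <= y2 by apply: le_trans hy; exact: sqr_ge0.
have z20 : 0 <= z2 by apply: le_trans hz; exact: sqr_ge0.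
have C0 : 0 <= C by rewrite !addr_ge0// mulr_ge0// addr_ge0.
suff H n : forall t, 0 <= t <= 1 ->
  Bmin_le ((1 - t) * y1 + t * z1) ((1 - t) * y2 + t * z2) ((1 - t) * y3 + t * z3)
    ((1 - t) * v + t * w + 2^-1 ^+ n * C).
  apply: Bmin_le_lim => e e0.
  have [n hn] := geometric_small _ 2^-1 C e ltac:(apply/andP; split; lra) e0.
  by apply: Bmin_le_mono (H n t ht); rewrite lerD2l.
elim: n {t ht} => [|n IH] t /andP[t0 t1].
  (* [C] is large enough to make up for the difference between the crude value and the interpolated
     one. *)
  apply: (Bmin_le_mono _ _ _ (((1 - t) * y2 + t * z2) * ((1 - t) * y3 + t * z3))).
    rewrite expr0 mul1r /C.
    have hv : - `|v| <= v by rewrite lerNl ler_normr lexx orbT.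
    have hw : - `|w| <= w by rewrite lerNl ler_normr lexx orbT.
    have nv : 0 <= `|v| by []. have nw : 0 <= `|w| by [].
    have /andP[h3' h3] : 0 <= (1 - t) * y3 + t * z3 <= M.
      by apply: conv_itv; rewrite ?t0 ?t1 ?yM ?zM// (le_trans m0).
    have /andP[h2' h2] : 0 <= (1 - t) * y2 + t * z2 <= y2 + z2.
      by apply: conv_itv; rewrite ?t0 ?t1 ?y20 ?z20//= ?lerDl ?lerDr.
    have /andP[h1 _] : - (`|v| + `|w|) <= (1 - t) * v + t * w <= `|v| + `|w|.
      apply: conv_itv; rewrite ?t0 ?t1// -ler_norml ?lerDl ?lerDr//.
    by have := ler_pM h2' h3' h2 h3; lra.
  apply: Bmin_le_crude; last by apply: conv_itv; rewrite ?t0 ?t1.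
  (* The gap in the inequality is the same combination of the gaps at the two ends plus
     [t * (1 - t) * (y1 - z1) ^+ 2]. *)
  have := mulr_ge0 (mulr_ge0 t0 (_ : 0 <= 1 - t)) (sqr_ge0 (y1 - z1)).
  have := mulr_ge0 t0 (_ : 0 <= z2 - z1 ^+ 2).
  have := mulr_ge0 (_ : 0 <= 1 - t) (_ : 0 <= y2 - y1 ^+ 2).
  rewrite !subr_ge0 => /(_ t1 hy) h1 /(_ hz) h2 /(_ t1) h3; lra.
(* The point at [t] is the midpoint of the [y] end and the point at [2 * t], or of the point at
   [2 * t - 1] and the [z] end. *)
have [ht|ht] := leP t 2^-1.
  have T : 0 <= 2 * t <= 1 by apply/andP; split; lra.
  have X3 := conv_itv T Y3 Z3.
  have := Bmin_le_mid Y3 X3 Py (IH _ T).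
  by congr Bmin_le; rewrite ?exprS; field.
have T : 0 <= 2 * t - 1 <= 1 by apply/andP; split; lra.
have X3 := conv_itv T Y3 Z3.
have := Bmin_le_mid X3 Z3 (IH _ T) Pz.
by congr Bmin_le; rewrite ?exprS; field.
Qed.

(** * Values at the top [x3 = M], and on the extremal segments ending there *)

Section Top.
Variable b : R.
Hypothesis b0 : 0 < b.
Let D := M - m.
(** With [b = -2 a (M - m)], the cubic equation at [x3 = M] says that [k] is the ratio of [x2] to
    [x1 ^+ 2]. *)
Let k := (1 + b) ^+ 2 / (1 + 2 * b).

(** A bound homogeneous in [y], with an unknown constant [w] to be improved from [k] down to the
    inverse of [1 + 2 * b]. *)
Let top_le w := forall y, Bmin_le y (k * y ^+ 2) M (m * (k * y ^+ 2) + D * w * y ^+ 2).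

Let k1 : 1 <= k.
Proof.
move: b0 => b0'; rewrite ler_pdivlMr; last by lra.
by have := sqr_ge0 b; lra.
Qed.

Let top_init : top_le k.
Proof.
move=> y; have hM : m <= M <= M by rewrite (ltW mM) lexx.
have := Bmin_le_crude y (k * y ^+ 2) M (ler_peMl (sqr_ge0 y) k1) hM.
by congr Bmin_le; rewrite /D; ring.
Qed.

(** The bound at [q * y] implies a bound at [y], so [w] is transformed by an affine contraction. The
    mixture has third coordinate [M - D * e], and a jump by [D * e] returns it to [M]. *)
Let top_step e w : 0 < e < 1 -> top_le w -> top_le (e + (1 - e) / (1 + b * e) ^+ 2 * w).
Proof.
move=> /andP[e0 e1] h y; move: b0 m0 mM => b0' m0' mM'.
have be : 0 < b * e by exact: mulr_gt0.
pose q := (1 + b * e)^-1.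
have q0 : 1 + b * e != 0 by apply: lt0r_neq0; lra.
have q1 : 1 + 2 * b != 0 by apply: lt0r_neq0; lra.
(* These are forced by the first two coordinates of the mixture. The choice of [q] leaves the gap
   [z2 - z1 ^+ 2] of order [e], so that this end approaches the parabola. *)
pose z1 := y * (1 + b) * q; pose z2 := k * y ^+ 2 * q ^+ 2 * (1 + 2 * b + b ^+ 2 * e).
have hz : z1 ^+ 2 <= z2.
  rewrite -subr_ge0 [leRHS](_ : _ = (y * q * (1 + b) * b) ^+ 2 * (e / (1 + 2 * b))).
    by rewrite mulr_ge0 ?sqr_ge0// divr_ge0; lra.
  by rewrite /z1 /z2 /k; field.
have hm : m <= m <= M by rewrite lexx ltW.
have hM : m <= M <= M by rewrite lexx ltW.
have ht : 0 <= 1 - e <= 1 by apply/andP; split; lra.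
have hq : (q * y) ^+ 2 <= k * (q * y) ^+ 2 by exact: ler_peMl (sqr_ge0 _) k1.
have := Bmin_le_conv hz hq hm hM (Bmin_le_crude _ _ _ hz hm) (h (q * y)) ht.
have De : 0 <= D * e by rewrite mulr_ge0 /D; lra.
have h3 := conv_itv ht hm hM.
have h3' : (1 - (1 - e)) * m + (1 - e) * M + D * e <= M by rewrite /D; lra.
move=> /(Bmin_le_jump De (andP h3).1 h3').
by congr Bmin_le; rewrite /z1 /z2 /q /k /D; field; rewrite ?q0 ?q1.
Qed.

Lemma Bmin_le_top y :
  Bmin_le y ((1 + b) ^+ 2 / (1 + 2 * b) * y ^+ 2) M
    (m * ((1 + b) ^+ 2 / (1 + 2 * b) * y ^+ 2) + (M - m) * (1 + 2 * b)^-1 * y ^+ 2).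
Proof.
rewrite -/k -/D; move: b0 m0 mM => b0' m0' mM'.
have D0 : 0 < D by rewrite /D; lra.
(* For fixed [e] the value displayed is the fixed point of the contraction of [top_step]; iterating
   from [k] converges to it geometrically. *)
have fixpt e : 0 < e < 1 -> top_le ((1 + b * e) ^+ 2 / (1 + 2 * b + b ^+ 2 * e)).
  move=> /[dup] he /andP[e0 e1].
  have be : 0 < b * e by exact: mulr_gt0.
  have bbe : 0 < b ^+ 2 * e by rewrite mulr_gt0// exprn_gt0.
  set w := _ / _; set q := (1 - e) / (1 + b * e) ^+ 2.
  have q01 : 0 <= q < 1.
    apply/andP; split; first by rewrite divr_ge0 ?exprn_ge0//; lra.
    rewrite ltr_pdivrMr ?exprn_gt0//; last by lra.
    by rewrite mul1r; have := sqr_ge0 (b * e); lra.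
  have wE : w = e + q * w.
    by rewrite /w /q; field; apply/andP; split; apply: lt0r_neq0; lra.
  have iter n : top_le (w + q ^+ n * (k - w)).
    elim: n => [|n IH]; first by rewrite expr0 mul1r addrC subrK; exact: top_init.
    have := top_step _ _ he IH; rewrite -/q; congr top_le.
    by rewrite {3}wE exprS; ring.
  move=> z; apply: Bmin_le_lim => r r0.
  have [n hn] := geometric_small _ q ((k - w) * D * z ^+ 2) r q01 r0.
  by apply: Bmin_le_mono (iter n z); lra.
apply: Bmin_le_lim => r r0.
pose C := D * (2 * b + b ^+ 2) * y ^+ 2.
have bb0 : 0 <= 2 * b + b ^+ 2 by rewrite addr_ge0 ?sqr_ge0//; lra.
have C0 : 0 <= C by rewrite /C mulr_ge0 ?sqr_ge0// mulr_ge0// ltW.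
(* This keeps [e] below 1 and [e * C] at most [r], where [C] bounds the rate at which the fixed
   point approaches its limit as [e] tends to 0. *)
pose e := r / (1 + C + r).
have e01 : 0 < e < 1.
  apply/andP; split; first by rewrite divr_gt0//; lra.
  by rewrite ltr_pdivrMr; lra.
have eC : e * C <= r.
  rewrite mulrAC ler_pdivrMr; last by lra.
  by rewrite ler_wpM2l//; lra.
have /andP[e0 e1] := e01.
apply: Bmin_le_mono (fixpt e e01 y).
suff wle : (1 + b * e) ^+ 2 / (1 + 2 * b + b ^+ 2 * e) <=
    (1 + 2 * b)^-1 + e * (2 * b + b ^+ 2).
  have := ler_wpM2r (sqr_ge0 y) (ler_wpM2l (ltW D0) wle).
  by move: eC; rewrite /C; lra.
have bbe : 0 <= b ^+ 2 * e by rewrite mulr_ge0// ?sqr_ge0 ?ltW.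
rewrite ler_pdivrMr; last by lra.
have v0 : 0 <= (1 + 2 * b)^-1 by rewrite invr_ge0; lra.
have vE : (1 + 2 * b)^-1 * (1 + 2 * b) = 1 by rewrite mulVf// lt0r_neq0//; lra.
rewrite mulrDl mulrDr vE.
have h1 := mulr_ge0 v0 bbe.
have h2 : 0 <= b ^+ 2 * e * (1 - e) by rewrite mulr_ge0//; lra.
have h3 : 0 <= e * (2 * b + b ^+ 2) * (2 * b + b ^+ 2 * e).
  by apply: mulr_ge0; [rewrite mulr_ge0// ltW|lra].
by lra.
Qed.

(** The point divides the segment from [(u, u^2, m)] to the top point with first coordinate
    [u / (1 + b)]; the top end has weight [1 - C]. *)
Lemma Bmin_le_upper u x3 C : 0 <= C <= 1 -> x3 = M - (M - m) * C ->
  Bmin_le (u * (1 + b * C) / (1 + b)) (u ^+ 2 * (1 + 2 * b * C) / (1 + 2 * b)) x3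
    (m * (u ^+ 2 * (1 + 2 * b * C) / (1 + 2 * b)) +
     (x3 - m) * u ^+ 2 / ((1 + b) ^+ 2 * (1 + 2 * b))).
Proof.
move=> /andP[C0 C1] ->; move: b0 mM m0 => b0' mM' m0'.
have hm : m <= m <= M by rewrite lexx ltW.
have hM : m <= M <= M by rewrite lexx ltW.
have ht : 0 <= 1 - C <= 1 by apply/andP; split; lra.
pose y := u / (1 + b).
have := Bmin_le_conv (lexx _) (ler_peMl (sqr_ge0 y) k1) hm hM
  (Bmin_le_crude u _ _ (lexx _) hm) (Bmin_le_top y) ht.
congr Bmin_le; rewrite /y /k /D; field; rewrite ?lt0r_neq0//; lra.
Qed.

End Top.

(** All the extra mass is placed where the function vanishes: the point is a mixture of [(0, 0, M)]
    and a point with third coordinate [m]. The bound on [x3] says exactly that the latter satisfies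
    Jensen's inequality. *)
Lemma Bmin_le_flat x1 x2 x3 : 0 < x2 -> m <= x3 -> x3 <= M - (M - m) * (x1 ^+ 2 / x2) ->
  Bmin_le x1 x2 x3 (m * x2).
Proof.
move=> x20 mx hx; move: mM m0 => mM' m0'.
have D0 : 0 < M - m by lra.
have h12 : (M - m) * x1 ^+ 2 <= (M - x3) * x2.
  by rewrite -ler_pdivrMr// -mulrA; lra.
have hm : m <= m <= M by rewrite lexx ltW.
have hM : m <= M <= M by rewrite lexx ltW.
have xM : x3 <= M.
  by apply: le_trans hx _; rewrite gerBl mulr_ge0 ?divr_ge0 ?sqr_ge0//; lra.
have crude y1 y2 : y1 ^+ 2 <= y2 -> Bmin_le y1 y2 m (m * y2).
  by move=> hy; rewrite mulrC; exact: Bmin_le_crude.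
(* At [x3 = M] the mixture would degenerate, but then [x1 = 0] and mass added at the root costs
   nothing. *)
move: xM; rewrite le_eqVlt => /orP[/eqP xM|xM].
  have x10 : x1 = 0.
    apply/eqP; rewrite -sqrf_eq0 eq_le sqr_ge0 andbT.
    by rewrite -(ler_pM2l D0) mulr0; apply: le_trans h12 _; rewrite xM subrr mul0r.
  rewrite x10 xM.
  have h0 : (0 : R) ^+ 2 <= x2 by rewrite expr0n/= ltW.
  have hj : m + (M - m) <= M by lra.
  have := Bmin_le_jump (ltW D0) (lexx m) hj (crude _ _ h0).
  by congr Bmin_le; ring.
pose t := (x3 - m) / (M - m).
have ht : 0 <= t <= 1.
  by rewrite /t divr_ge0 ?ler_pdivrMr// ?mul1r; lra.
have tE : 1 - t = (M - x3) / (M - m) by rewrite /t; field; exact: lt0r_neq0.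
have t1 : 0 < 1 - t by rewrite tE divr_gt0//; lra.
have hy : (x1 / (1 - t)) ^+ 2 <= x2 / (1 - t).
  rewrite expr_div_n ler_pdivrMr ?exprn_gt0//.
  rewrite expr2 mulrA divfK ?lt0r_neq0//.
  by rewrite tE mulrA ler_pdivlMr// mulrC [x2 * _]mulrC.
have z0 : (0 : R) ^+ 2 <= 0 by rewrite expr0n.
have := Bmin_le_conv hy z0 hm hM (crude _ _ hy) (Bmin_le_crude _ _ _ z0 hM) ht.
have t1' := lt0r_neq0 t1; have D1 := lt0r_neq0 D0.
congr Bmin_le; rewrite ?mul0r ?mulr0 ?addr0 ?[(1 - t) * (_ / _)]mulrC ?divfK//.
- by rewrite tE /t; field.
- by rewrite mulrCA [(1 - t) * _]mulrC divfK.
Qed.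

End UpperBound.

(** * Measures dominated on dyadic intervals *)

Section AbsolutelyContinuous.
Context {R : realType}.
Local Notation leb := (@lebesgue_measure R).
Variables (M : R) (mu : {measure set (measurableTypeR R) -> \bar R}).

(** Bisect until the pieces have length at most [delta]. A piece that meets []a, b]] is then
    contained in the enlarged interval, and the other pieces contribute nothing. *)
Lemma dyadic_dominated_itv n (a b delta : R) bl c br d : 0 <= M -> c < d ->
  (forall J, dyadic (itv bl c br d) J -> (mu [set` J] <= (M * len J)%:E)%E) ->
  len (itv bl c br d) <= 2 ^+ n * delta ->
  (mu ([set` itv bl c br d] `&` `]a, b]) <=
   M%:E * leb ([set` itv bl c br d] `&` `[(a - delta)%R, (b + delta)%R]))%E.
Proof.
move=> M0; elim: n bl c br d => [|n IH] bl c br d cd hmu hl.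
  have [e0|/set0P[t [It abt]]] := eqVneq ([set` itv bl c br d] `&` `]a, b]) set0.
    by rewrite e0 measure0 mule_ge0// lee_fin.
  have mI := measurable_itvR bl c br d.
  apply: (@le_trans _ _ (mu [set` itv bl c br d])).
    by apply: le_measure; rewrite ?inE//=; exact: measurableI.
  rewrite [in leRHS](_ : _ `&` _ = [set` itv bl c br d]).
    by rewrite lebesgue_itv// -EFinM; exact/hmu/dyadic_self.
  apply/setIidl => s Is; move: hl; rewrite expr0 mul1r len_itv// => hl.
  have cl u : [set` itv bl c br d] u -> c <= u <= d.
    by rewrite /= in_itv/=; case: (bl); case: (br) => /andP[? ?]; apply/andP; split=> //; exact: ltW.
  move: (cl _ It) (cl _ Is) abt => /andP[h1 h2] /andP[h3 h4].
  by rewrite /= !in_itv/= => /andP[h5 h6]; apply/andP; split; lra.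
have cm : c < (c + d) / 2 by lra.
have md : (c + d) / 2 < d by lra.
have [hll hlr] := len_halves bl br _ _ cd.
have hl2 : len (itv bl c br d) / 2 <= 2 ^+ n * delta by move: hl; rewrite exprS; lra.
rewrite (halvesE cd) !setIUl.
have mI b1 c1 b2 d1 b3 c3 b4 d3 : measurable
    ([set` itv b1 c1 b2 d1] `&` [set` itv b3 c3 b4 d3] : set (measurableTypeR R)).
  by apply: measurableI; exact: measurable_itvR.
have dis (A : set R) : [set` itv bl c true ((c + d) / 2)] `&` A `&`
    ([set` itv true ((c + d) / 2) br d] `&` A) = set0.
  rewrite setIACA; have /disj_set2P -> := halves_disj bl br c d.
  by rewrite set0I.
rewrite [leLHS]measureU ?dis//; [|exact: mI|exact: mI].
rewrite [X in (_ * X)%E]measureU ?dis//; [|exact: mI|exact: mI].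
rewrite ge0_muleDr//; apply: leeD; apply: IH; rewrite ?hll ?hlr// => J h; apply: hmu;
  rewrite (dyadic_itvE bl c br d); right; first by left.
by right.
Qed.

(** Letting [delta] tend to 0 gives the bound on half-open intervals, and covers by such intervals
    carry it over to Borel sets. *)
Lemma dyadic_dominated bl c br d (A : set (measurableTypeR R)) : 0 < M -> c < d ->
  (forall J, dyadic (itv bl c br d) J -> (mu [set` J] <= (M * len J)%:E)%E) ->
  measurable A -> A `<=` [set` itv bl c br d] -> (mu A <= M%:E * leb A)%E.
Proof.
move=> M0 cd hmu mA AI; have mI := measurable_itvR bl c br d.
have itvle (a b : R) : a < b ->
    (mu ([set` itv bl c br d] `&` `]a, b]) <= (M * (b - a))%:E)%E.
  move=> ab; apply/lee_addgt0Pr => e e0.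
  pose delta := e / (2 * M).
  have d0 : 0 < delta by rewrite divr_gt0// mulr_gt0.
  have [n hn] := geometric_small _ 2^-1 (len (itv bl c br d)) _ ltac:(apply/andP; split; lra) d0.
  rewrite exprVn ler_pdivrMl ?exprn_gt0// in hn.
  apply: le_trans (dyadic_dominated_itv n a b delta _ _ _ _ (ltW M0) cd hmu hn) _.
  apply: (@le_trans _ _ (M%:E * leb `[(a - delta)%R, (b + delta)%R])%E).
    by rewrite lee_pmul2l//; apply: le_measure; rewrite ?inE//=; exact: measurableI.
  rewrite lebesgue_measure_itv/= lte_fin ifT; last by lra.
  rewrite -EFinD -EFinM -EFinD lee_fin /delta.
  by rewrite le_eqVlt; apply/orP; left; apply/eqP; field; exact: lt0r_neq0.
(* Lebesgue measure is unfolded as an infimum over countable covers by half-open intervals. *)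
rewrite -lee_pdivrMl//; apply: le_ereal_inf_tmp => _ [F [mF AF] <-].
rewrite lee_pdivrMl//.
have mFI k : measurable ([set` itv bl c br d] `&` F k : set (measurableTypeR R)).
  by apply: measurableI => //; apply: sub_sigma_algebra; exact: mF.
apply: (@le_trans _ _ (\sum_(k <oo) mu ([set` itv bl c br d] `&` F k))%E).
  apply: measure_sigma_subadditive => //.
  by rewrite -setI_bigcupr => t At; split; [exact: AI|exact: AF].
rewrite -nneseriesZl//; apply: lee_nneseries => // k _.
have /ocitvP[->|[[a b] /= ab ->]] := mF k.
  by rewrite setI0 measure0 mule_ge0// lee_fin ltW.
apply: le_trans (itvle _ _ ab) _.
by rewrite wlength_itv_bnd// -?EFinM// ltW.
Qed.

Lemma ge0_integral_dominated bl c br d (f : R -> \bar R) : 0 < M -> c < d ->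
  (forall J, dyadic (itv bl c br d) J -> (mu [set` J] <= (M * len J)%:E)%E) ->
  (forall x, (0 <= f x)%E) ->
  measurable_fun [set` itv bl c br d] f ->
  (\int[mu]_(x in [set` itv bl c br d]) f x <=
   M%:E * \int[leb]_(x in [set` itv bl c br d]) f x)%E.
Proof.
move=> M0 cd hmu f0 mf; have mI := measurable_itvR bl c br d.
pose nu : {measure set (measurableTypeR R) -> \bar R} := mrestr mu mI.
pose la : {measure set (measurableTypeR R) -> \bar R} :=
  mscale (NngNum (ltW M0)) leb.
rewrite [leRHS](_ : _ = \int[la]_(x in [set` itv bl c br d]) f x)%E; last first.
  by rewrite ge0_integral_mscale.
rewrite (eq_measure_integral nu); last first.
  by move=> A mA AI; rewrite /nu/= /mrestr setIidl.
rewrite integral_mkcond [leRHS]integral_mkcond.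
apply: ge0_le_measure_integral => //.
- move=> S mS; rewrite [leLHS](_ : _ = mu (S `&` [set` itv bl c br d]))//.
  apply: le_trans (dyadic_dominated _ _ _ _ (S `&` [set` itv bl c br d]) M0 cd hmu _ _) _ => //.
    exact: measurableI.
  rewrite [leRHS](_ : _ = (M%:E * leb S)%E)// lee_pmul2l//.
  by apply: le_measure; rewrite ?inE//; exact: measurableI.
- by move=> x; rewrite erestrict_ge0.
- exact/(measurable_restrictT _ _).1.
Qed.

End AbsolutelyContinuous.

(** * The lower bound *)

Section Descent.
Context {R : realType}.
Implicit Types (c d : R) (J K : interval R).
Local Notation leb := (@lebesgue_measure R).

Section Facts.
Context {m M x1 x2 x3 : R} {phi : R -> R}.
Context {mu : {measure set (measurableTypeR R) -> \bar R}} {al : interval R -> R}.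
Context {bl br : bool} {c d : R}.
Hypotheses (cd : c < d) (adm : admissible (itv bl c br d) x1 x2 x3 m M phi mu al).
Local Notation I := (itv bl c br d).
Local Notation Il := (itv bl c true ((c + d) / 2)).
Local Notation Ir := (itv true ((c + d) / 2) br d).

Lemma adm_itv : m <= x3 <= M.
Proof.
have := adm_carleson adm (dyadic_self I).
rewrite (adm_massE cd adm) !lee_fin.
by rewrite !ler_pM2r// len_gt0.
Qed.

(** Integrate the square of [phi t - x1]. *)
Lemma adm_jensen : x1 ^+ 2 <= x2.
Proof.
have l0 := len_gt0 bl _ br _ cd.
have fi := adm_integrable adm; have f2 := adm_sqr_int adm.
have h1 : (x1 * len I = \int[leb]_(t in [set` I]) phi t)%R.
  by rewrite -(adm_avg adm) /avg mulrAC mulVf ?mul1r// lt0r_neq0.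
have h2 : (x2 * len I = \int[leb]_(t in [set` I]) (phi t ^+ 2))%R.
  by rewrite -(adm_avg_sqr adm) /avg mulrAC mulVf ?mul1r// lt0r_neq0.
have h3 : (x1 ^+ 2 * len I = \int[leb]_(t in [set` I]) (x1 ^+ 2))%R.
  by rewrite Rintegral_cst//= lebesgue_itv.
have i3 : leb.-integrable [set` I] (EFin \o (fun=> x1 ^+ 2)) by exact: integrable_cst_itv.
have i1 : leb.-integrable [set` I] (EFin \o (fun t => 2 * x1 * phi t)).
  by apply: eq_integrable (integrableZl _ (2 * x1) fi) => //.
have : (0 <= \int[leb]_(t in [set` I]) ((phi t ^+ 2 - 2 * x1 * phi t) + x1 ^+ 2))%R.
  by apply: Rintegral_ge0 => t _; have := sqr_ge0 (phi t - x1); lra.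
rewrite RintegralD//; last by apply: eq_integrable (integrableB _ f2 i1).
rewrite RintegralB// RintegralZl// -h1 -h2 -h3.
have -> : x2 * len I - 2 * x1 * (x1 * len I) + x1 ^+ 2 * len I = (x2 - x1 ^+ 2) * len I by ring.
by rewrite pmulr_lge0// subr_ge0.
Qed.

Let adm_sub b1 c1 b2 d1 : c1 < d1 -> dyadic I (itv b1 c1 b2 d1) ->
  admissible (itv b1 c1 b2 d1) (avg phi (itv b1 c1 b2 d1))
    (avg (fun t => phi t ^+ 2) (itv b1 c1 b2 d1))
    (fine (mu [set` itv b1 c1 b2 d1] + \esum_(J in dyadic (itv b1 c1 b2 d1)) (al J)%:E)
      / len (itv b1 c1 b2 d1)) m M phi mu al.
Proof.
move=> cd1 h; have sub := dyadic_sub cd h.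
have mI := measurable_itvR bl c br d; have mJ := measurable_itvR b1 c1 b2 d1.
have l0 := len_gt0 b1 _ b2 _ cd1.
split=> //.
- exact: measurable_funS sub (adm_meas adm).
- exact: integrableS mI mJ sub (adm_sqr_int adm).
- by move=> t tJ; apply: (adm_atomless adm); exact: (sub t).
- by move=> J hJ; apply: (adm_alpha_ge0 adm); exact: dyadic_trans hJ.
- rewrite [in RHS]mulrC EFinM fineK//.
  have /andP[h1 h2] := adm_carleson adm h.
  by rewrite fin_real// (lt_le_trans _ h1) ?ltNyr// (le_lt_trans h2) ?ltry.
- by move=> J hJ; apply: (adm_carleson adm); exact: dyadic_trans hJ.
Qed.

(** The converse of gluing: the same [phi], [mu] and [al] are admissible on each half for the
    averages they have there, and the root weight accounts for the jump in the third coordinate. *)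
Lemma adm_split : exists y1 y2 y3 z1 z2 z3,
  [/\ admissible Il y1 y2 y3 m M phi mu al, admissible Ir z1 z2 z3 m M phi mu al &
   [/\ x1 = (y1 + z1) / 2, x2 = (y2 + z2) / 2 & x3 = (y3 + z3) / 2 + al I / len I]].
Proof.
have cm : c < (c + d) / 2 by move: cd => ?; lra.
have md : (c + d) / 2 < d by move: cd => ?; lra.
have dl : dyadic I Il by rewrite dyadic_itvE; right; left; exact: dyadic_self.
have dr : dyadic I Ir by rewrite dyadic_itvE; right; right; exact: dyadic_self.
have al0 := adm_alpha_ge0 adm.
do 6!eexists; split; [exact: adm_sub dl|exact: adm_sub dr|split].
- rewrite -avg_halves// ?(adm_avg adm)//; exact: adm_integrable adm.
- rewrite -avg_halves// ?(adm_avg_sqr adm)//; exact: (adm_sqr_int adm).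
have l0 := len_gt0 bl _ br _ cd.
have := adm_massE cd adm.
rewrite esum_dyadicE// (halvesE cd) measureU//; last exact/disj_set2P/halves_disj.
rewrite addeCA addeACA.
rewrite (adm_massE cm (adm_sub _ _ _ _ cm dl)).
rewrite (adm_massE md (adm_sub _ _ _ _ md dr)).
set y := fine _ / _; set z := fine _ / _; have [-> ->] := len_halves bl br _ _ cd.
rewrite -!EFinD => -[e]; apply: (mulIf (lt0r_neq0 l0)); rewrite -e.
by rewrite /=; field; exact: lt0r_neq0.
Qed.

End Facts.
End Descent.

(** * Descent of the dyadic tree to a finite depth, with explicit error terms *)

Section Tree.
Context {R : realType}.
Implicit Types (c d : R) (J K : interval R).
Local Notation leb := (@lebesgue_measure R).
Variables (m M : R) (phi : R -> R).
Variables (mu : {measure set (measurableTypeR R) -> \bar R}) (al : interval R -> R).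

(** It bounds the weights at and below the leaves of the finite descent, whose lengths are at most
    [r]. *)
Definition tail_mass (r : R) J : \bar R :=
  (\esum_(K in dyadic J `&` [set K | (len K <= r)%R]) (al K)%:E)%E.

Lemma tail_mass_halves r bl c br d : c < d ->
  (forall J, dyadic (itv bl c br d) J -> 0 <= al J) ->
  (tail_mass r (itv bl c true ((c + d) / 2)) + tail_mass r (itv true ((c + d) / 2) br d)
   <= tail_mass r (itv bl c br d))%E.
Proof.
move=> cd al0; rewrite /tail_mass !esum_mkcondr (esum_dyadicE cd)//.
  by rewrite leeDr//; case: ifP => // _; rewrite lee_fin; exact/al0/dyadic_self.
by move=> J h; case: ifP => // _; rewrite lee_fin; exact: al0.
Qed.

Lemma tail_mass_small r bl c br d : c < d -> len (itv bl c br d) <= r ->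
  tail_mass r (itv bl c br d) = (\esum_(K in dyadic (itv bl c br d)) (al K)%:E)%E.
Proof.
move=> cd hr; rewrite /tail_mass setIidl// => K /(dyadic_itv cd)[b [x [b' [y [-> h1 h2 h3]]]]].
by apply: le_trans hr; rewrite !len_itv//; lra.
Qed.

Variable H : R -> R -> R -> R.
Hypothesis Hmain : forall y1 y2 y3 z1 z2 z3 a,
  y1 ^+ 2 <= y2 -> m <= y3 <= M -> z1 ^+ 2 <= z2 -> m <= z3 <= M -> 0 <= a ->
  (y3 + z3) / 2 + a <= M ->
  H ((y1 + z1) / 2) ((y2 + z2) / 2) ((y3 + z3) / 2 + a) <=
    (H y1 y2 y3 + H z1 z2 z3) / 2 + ((y1 + z1) / 2) ^+ 2 * a.
Hypothesis Hterm : forall x1 x2 x3, x1 ^+ 2 <= x2 -> m <= x3 <= M -> H x1 x2 x3 <= x2 * x3.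
Hypothesis m0 : 0 <= m.

(** [g] stands for a bounded approximation of [phi ^+ 2] that varies by at most [e] at scale [r],
    and [k] for the pointwise error of this approximation. *)
Variables (I : interval R) (g k : R -> R) (G e r : R).
Hypotheses (e0 : 0 <= e) (g0 : forall t, 0 <= g t) (k0 : forall t, 0 <= k t).
Hypotheses (gi : leb.-integrable [set` I] (EFin \o g))
           (ki : leb.-integrable [set` I] (EFin \o k)).
Hypothesis gG : forall t, t \in I -> g t <= G.
Hypothesis hgk : forall t, t \in I -> phi t ^+ 2 <= g t + k t.
Hypothesis ghk : forall t, t \in I -> g t <= phi t ^+ 2 + k t.
Hypothesis osc : forall s t, s \in I -> t \in I -> `|s - t| <= r -> g s <= g t + e.

Let err J : \bar R :=
  (\int[mu]_(t in [set` J]) (phi t ^+ 2 + k t + e)%:E + M%:E * \int[leb]_(t in [set` J]) (k t)%:E)%E.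

Let mphik b c b' d : [set` itv b c b' d] `<=` [set` I] ->
  measurable_fun [set` itv b c b' d] phi ->
  measurable_fun [set` itv b c b' d] (fun t => (phi t ^+ 2 + k t + e)%:E) /\
  measurable_fun [set` itv b c b' d] (fun t => (k t)%:E).
Proof.
move=> JI mphi; have mJ := measurable_itvR b c b' d.
have mk : measurable_fun [set` itv b c b' d] k.
  by apply: measurable_funS JI _ => //; apply/measurable_EFinP; case/integrableP: ki.
split; apply/measurable_EFinP => //.
by apply: measurable_funD => //; apply: measurable_funD => //; exact: measurable_funX.
Qed.

(** Bound [x2] by the averages of [g] and [k]. Against [mu], the average of [g] is at most
    [phi t ^+ 2 + k t + e] at each point of the leaf; against the weights it is at most [G]; and the
    average of [k] is multiplied by at most [M]. *)
Let leaf bl c br d x1 x2 x3 : c < d -> 0 <= M ->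
  [set` itv bl c br d] `<=` [set` I] ->
  admissible (itv bl c br d) x1 x2 x3 m M phi mu al -> len (itv bl c br d) <= r ->
  ((len (itv bl c br d) * (x2 * x3))%:E <=
   err (itv bl c br d) + G%:E * tail_mass r (itv bl c br d))%E.
Proof.
move=> cd M0 JI adm hr; set J := itv bl c br d.
have l0 : 0 < len J := len_gt0 bl _ br _ cd.
have mJ := measurable_itvR bl c br d.
have mI : measurable ([set` I] : set (measurableTypeR R)) by exact: measurable_itv.
have gJ : leb.-integrable [set` J] (EFin \o g) by exact: integrableS mI mJ JI gi.
have kJ : leb.-integrable [set` J] (EFin \o k) by exact: integrableS mI mJ JI ki.
have /andP[mx xM] := adm_itv cd adm.
have [mphik1 mphik2] := mphik _ _ _ _ JI (adm_meas adm).
have x2le : x2 <= avg g J + avg k J.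
  rewrite -(adm_avg_sqr adm) /avg -mulrDr -RintegralD//.
  rewrite ler_wpM2l ?invr_ge0 ?(ltW l0)//; apply: le_Rintegral => //.
  - exact: (adm_sqr_int adm).
  - by apply: eq_integrable (integrableD _ gJ kJ).
  - by move=> t /JI; exact: hgk.
have B0 : 0 <= avg g J by rewrite mulr_ge0 ?invr_ge0 ?(ltW l0)// Rintegral_ge0.
have Jcst (q : R) : q = avg (fun=> q) J by rewrite avg_cst.
have avgle (p q : R -> R) : leb.-integrable [set` J] (EFin \o p) ->
    leb.-integrable [set` J] (EFin \o q) -> (forall t, t \in J -> p t <= q t) ->
    avg p J <= avg q J.
  by move=> pi qi pq; rewrite ler_wpM2l ?invr_ge0 ?(ltW l0)//; exact: le_Rintegral.
have BG : avg g J <= G.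
  rewrite [leRHS]Jcst; apply: avgle => //; first exact: integrable_cst_itv.
  by move=> t /JI; exact: gG.
have Bh t : t \in J -> avg g J <= phi t ^+ 2 + k t + e.
  move=> tJ; apply: (@le_trans _ _ (g t + e)); last by rewrite lerD2r; exact/ghk/JI.
  rewrite [leRHS]Jcst; apply: avgle => //; first exact: integrable_cst_itv.
  move=> s sJ; apply: osc; [exact: JI|exact: JI|].
  have bd u : u \in J -> c <= u <= d.
    by rewrite in_itv/=; case: (bl); case: (br) => /andP[? ?]; apply/andP; split=> //; exact: ltW.
  move: (bd _ sJ) (bd _ tJ) hr => /andP[? ?] /andP[? ?]; rewrite len_itv// => hr.
  by rewrite ler_norml; apply/andP; split; lra.
have kE : (avg k J * len J)%:E = (\int[leb]_(t in [set` J]) (k t)%:E)%E.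
  rewrite /avg mulrAC mulVf ?mul1r ?lt0r_neq0//.
  rewrite /Rintegral fineK//; exact: integrable_fin_num.
have x30 : 0 <= x3 by apply: le_trans mx.
apply: (@le_trans _ _ ((avg g J)%:E * (mu [set` J] + \esum_(K in dyadic J) (al K)%:E) +
    M%:E * (avg k J * len J)%:E)%E).
  rewrite (adm_massE cd adm) -!EFinM -EFinD lee_fin.
  have := ler_wpM2r (ltW l0) (ler_wpM2r x30 x2le).
  have k00 : 0 <= avg k J by rewrite mulr_ge0 ?invr_ge0 ?(ltW l0)// Rintegral_ge0.
  have := ler_wpM2r (mulr_ge0 k00 (ltW l0)) xM; lra.
rewrite /err -kE tail_mass_small// -/J ge0_muleDr//; last first.
  by apply: esum_ge0 => K hK; rewrite lee_fin; exact: (adm_alpha_ge0 adm).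
rewrite -addeA [in leRHS]addeAC -[in leRHS]addeA; apply: leeD.
  by rewrite -integral_cst//; apply: ge0_le_integral.
apply: leeD => //; rewrite lee_wpmul2r//.
by apply: esum_ge0 => K hK; rewrite lee_fin; exact: (adm_alpha_ge0 adm).
Qed.

Let errD bl c br d : c < d -> 0 <= M -> [set` itv bl c br d] `<=` [set` I] ->
  measurable_fun [set` itv bl c br d] phi ->
  err (itv bl c br d) =
    (err (itv bl c true ((c + d) / 2)) + err (itv true ((c + d) / 2) br d))%E.
Proof.
move=> cd M0 JI mphi; have [m1 m2] := mphik _ _ _ _ JI mphi.
rewrite /err (halvesE cd) in m1 m2 *.
have disj := halves_disj bl br c d.
have p0 t : 0 <= phi t ^+ 2 + k t + e by rewrite !addr_ge0// sqr_ge0.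
rewrite !ge0_integral_setU//; try by move=> t _; rewrite lee_fin.
rewrite ge0_muleDr; first by rewrite addeACA.
- by apply: integral_ge0 => t _; rewrite lee_fin.
- by apply: integral_ge0 => t _; rewrite lee_fin.
Qed.

(** Each bisection pays for the weight at the root through [Hmain]; at the leaves [Hterm] and [leaf]
    take over, and the error terms are at least additive over halves. *)
Let descent_err n bl c br d x1 x2 x3 : c < d ->
  [set` itv bl c br d] `<=` [set` I] ->
  admissible (itv bl c br d) x1 x2 x3 m M phi mu al ->
  len (itv bl c br d) <= 2 ^+ n * r -> 0 <= G ->
  ((len (itv bl c br d) * H x1 x2 x3)%:E <=
   \esum_(J in dyadic (itv bl c br d)) (`|avg phi J| ^+ 2 * al J)%:E +
   (err (itv bl c br d) + G%:E * tail_mass r (itv bl c br d)))%E.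
Proof.
move=> + + + + G0; elim: n bl c br d x1 x2 x3 => [|n IH] bl c br d x1 x2 x3 cd JI adm hr.
  have l0 := len_gt0 bl _ br _ cd; rewrite expr0 mul1r in hr.
  have hx := adm_itv cd adm.
  have M0 : 0 <= M by case/andP: hx => h1 h2; exact: le_trans m0 (le_trans h1 h2).
  apply: (@le_trans _ _ (0 + (len (itv bl c br d) * (x2 * x3))%:E)%E).
    rewrite add0e lee_fin ler_pM2l//; apply: Hterm => //.
    exact: adm_jensen cd adm.
  apply: leeD; last exact: leaf adm hr.
  apply: esum_ge0 => K hK; rewrite lee_fin mulr_ge0 ?exprn_ge0//.
  exact: (adm_alpha_ge0 adm).
have cm : c < (c + d) / 2 by lra.
have md : (c + d) / 2 < d by lra.
have [hll hlr] := len_halves bl br _ _ cd.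
have hl2 : len (itv bl c br d) / 2 <= 2 ^+ n * r by move: hr; rewrite exprS; lra.
have l0 := len_gt0 bl _ br _ cd.
have hx := adm_itv cd adm.
have M0 : 0 <= M by case/andP: hx => h1 h2; exact: le_trans m0 (le_trans h1 h2).
have [y1 [y2 [y3 [z1 [z2 [z3 [admy admz [e1 e2 e3]]]]]]]] := adm_split cd adm.
have [subl subr] := halves_sub bl br _ _ cd.
have hl : len (itv bl c true ((c + d) / 2)) <= 2 ^+ n * r by rewrite hll.
have hr' : len (itv true ((c + d) / 2) br d) <= 2 ^+ n * r by rewrite hlr.
have IHl := IH _ _ _ _ _ _ _ cm (subset_trans subl JI) admy hl.
have IHr := IH _ _ _ _ _ _ _ md (subset_trans subr JI) admz hr'.
have al0 := adm_alpha_ge0 adm.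
have a0 : 0 <= al (itv bl c br d) by exact/al0/dyadic_self.
rewrite esum_dyadicE//; last first.
  by move=> K hK; rewrite lee_fin mulr_ge0 ?exprn_ge0// al0.
rewrite errD//; last exact: (adm_meas adm).
(* [Hmain] is used with the root weight per unit length as its jump, then multiplied by the
   length. *)
have HT : len (itv bl c br d) * H x1 x2 x3 <=
    `|avg phi (itv bl c br d)| ^+ 2 * al (itv bl c br d) +
    (len (itv bl c true ((c + d) / 2)) * H y1 y2 y3 +
     len (itv true ((c + d) / 2) br d) * H z1 z2 z3).
  have h3 : (y3 + z3) / 2 + al (itv bl c br d) / len (itv bl c br d) <= M.
    by rewrite -e3; case/andP: hx.
  have := Hmain _ _ _ _ _ _ _ (adm_jensen cm admy)
    (adm_itv cm admy) (adm_jensen md admz)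
    (adm_itv md admz) (divr_ge0 a0 (ltW l0)) h3.
  rewrite -e1 -e2 -e3 hll hlr => h; rewrite (adm_avg adm) real_normK ?num_real//.
  apply: le_trans (ler_wpM2l (ltW l0) h) _.
  by rewrite le_eqVlt; apply/orP; left; apply/eqP; field; exact: lt0r_neq0.
rewrite -lee_fin in HT; apply: le_trans HT _.
rewrite 2!EFinD -addeA; apply: leeD => //.
apply: le_trans (leeD IHl IHr) _.
rewrite addeACA; apply: leeD => //.
rewrite addeACA; apply: leeD => //.
rewrite -ge0_muleDr; first by rewrite lee_wpmul2l//; exact: tail_mass_halves.
- by apply: esum_ge0 => K [hK _]; rewrite lee_fin al0// dyadic_itvE; right; left.
- by apply: esum_ge0 => K [hK _]; rewrite lee_fin al0// dyadic_itvE; right; right.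
Qed.

Lemma descent n bl c br d x1 x2 x3 : c < d ->
  [set` itv bl c br d] `<=` [set` I] ->
  admissible (itv bl c br d) x1 x2 x3 m M phi mu al ->
  len (itv bl c br d) <= 2 ^+ n * r -> 0 <= G ->
  ((len (itv bl c br d) * H x1 x2 x3)%:E <=
   \esum_(J in dyadic (itv bl c br d)) (`|avg phi J| ^+ 2 * al J)%:E +
   (\int[mu]_(t in [set` itv bl c br d]) (phi t ^+ 2 + k t + e)%:E +
     M%:E * \int[leb]_(t in [set` itv bl c br d]) (k t)%:E +
   G%:E * tail_mass r (itv bl c br d)))%E.
Proof. exact: descent_err. Qed.

End Tree.

(** * Vanishing of the error terms, and the lower bound for the functional *)

Section Limit.
Context {R : realType}.
Implicit Types (c d : R) (J K : interval R).
Local Notation leb := (@lebesgue_measure R).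

(** Continuity provides a radius valid near each point, and compactness a common one. *)
Lemma segment_unif_continuous (g : R -> R) c d (e : R) : continuous g -> 0 < e ->
  exists2 r : R, 0 < r & forall s t, t \in `[c, d] -> `|s - t| <= r -> `|g s - g t| <= e.
Proof.
move=> cg e0.
have nc := (compact_near_coveringP _).1 (@segment_compact R c d).
pose P (r x : R) := forall s, `|s - x| <= r -> `|g s - g x| <= e.
suff H : forall x : R, `[c, d]%classic x -> \forall x' \near x & r \near (0 : R)^'+, P r x'.
  have {}H := nc _ _ P _ H.
  near (0 : R)^'+ => r; exists r; first by near: r; exact: nbhs_right_gt.
  have : `[c, d]%classic `<=` P r by near: r; exact: H.
  by move=> /[swap] s /[swap] t /[apply]; apply.
move=> x _.
have e20 : 0 < e / 2 by rewrite divr_gt0.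
move/cvgrPdist_lt: (cg x) => /(_ _ e20) /nbhs_ballP[delta /= d0 hd]; have {}d0 : (0 : R) < delta := d0.
  near=> x' r => s sr.
  have xx' : `|x - x'| < delta / 2.
    by near: x'; apply: nbhsx_ballx; rewrite divr_gt0.
  have rd : r < delta / 2 by near: r; apply: nbhs_right_lt; rewrite divr_gt0.
  have h1 : `|g x - g x'| < e / 2.
    by apply: hd; rewrite -ball_normE/=; lra.
  have h2 : `|g x - g s| < e / 2.
    apply: hd; rewrite -ball_normE/= (_ : x - s = (x - x') - (s - x')); last by ring.
    by apply: le_lt_trans (ler_normB _ _) _; rewrite [ltRHS]splitr ltrD// (le_lt_trans sr).
  rewrite (_ : g s - g x' = (g x - g x') - (g x - g s)); last by ring.
  by apply: le_trans (ler_normB _ _) _; lra.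
Unshelve. all: by end_near. Qed.

(** A finite subfamily carries all but [e] of the total. Its intervals have positive length, so for
    small [r] none of them belongs to the tail. *)
Lemma tail_mass_cvg (al : interval R -> R) bl c br d (e : R) : c < d ->
  (forall J, dyadic (itv bl c br d) J -> 0 <= al J) ->
  (\esum_(K in dyadic (itv bl c br d)) (al K)%:E < +oo)%E -> 0 < e ->
  exists2 r0 : R, 0 < r0 & forall r, r <= r0 -> (tail_mass al r (itv bl c br d) <= e%:E)%E.
Proof.
move=> cd al0 fin e0; set D := dyadic _ in fin *.
have s0 (A : set (interval R)) : A `<=` D -> (0 <= \esum_(K in A) (al K)%:E)%E.
  by move=> AD; apply: esum_ge0 => K /AD h; rewrite lee_fin; exact: al0.
have /ub_ereal_sup_adherent : (\esum_(K in D) (al K)%:E)%E \is a fin_num.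
  by rewrite ge0_fin_numE// s0.
move=> /(_ _ e0)[_ [X [finX XD] <-]]; rewrite -/(esum _ _) => hX.
have [F FE] := (finite_seqP _).1 finX.
have small (s : seq (interval R)) : (forall K, K \in s -> 0 < len K) ->
    exists2 r0 : R, 0 < r0 & forall K, K \in s -> r0 < len K.
  elim: s => [|K s IH] hs; first by exists 1.
  have [L LK|r1 r10 h1] := IH; first by apply: hs; rewrite inE LK orbT.
  have K0 := hs K (mem_head _ _).
  exists (Num.min r1 (len K / 2)); first by rewrite lt_min r10 divr_gt0.
  move=> L; rewrite inE => /orP[/eqP->|/h1 h]; rewrite gt_min ?h//.
  by apply/orP; right; lra.
have [K|r0 r00 hr0] := small F.
  move=> KF; have /XD/(dyadic_itv cd)[b [x [b' [y [-> _ xy _]]]]] : X K by rewrite FE.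
  exact: len_gt0.
exists r0 => // r rr0; rewrite /tail_mass -/D.
have := esumID [set K | len K <= r] D (fun K => (al K)%:E) (fun K h => al0 K h).
set T := (\esum_(K in D `&` _) _)%E; set U := (\esum_(K in D `&` ~` _) _)%E => hTU.
have XU : (\sum_(x \in X) (al x)%:E <= U)%E.
  apply: esum_ge; exists X => //; split=> // K XK; split; first exact: XD.
  move=> /= Kr; have : r0 < len K by apply: hr0; move: XK; rewrite FE.
  by move=> h; move: (lt_le_trans h (le_trans Kr rr0)); rewrite ltxx.
move: hX XU fin; rewrite hTU fsumEFin//.
have T0 : (0 <= T)%E by apply: s0 => K [].
have U0 : (0 <= U)%E by apply: s0 => K [].
move: T0 U0; case: T {hTU} => [t| |] //; case: U => [u| |] //=.
rewrite -?EFinD -?EFinB lte_fin !lee_fin => *; lra.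
Qed.

Section LowerBound.
Variables (m M : R) (H : R -> R -> R -> R).
Hypotheses (m0 : 0 <= m) (mM : m < M).
Hypothesis Hmain : forall y1 y2 y3 z1 z2 z3 a,
  y1 ^+ 2 <= y2 -> m <= y3 <= M -> z1 ^+ 2 <= z2 -> m <= z3 <= M -> 0 <= a ->
  (y3 + z3) / 2 + a <= M ->
  H ((y1 + z1) / 2) ((y2 + z2) / 2) ((y3 + z3) / 2 + a) <=
    (H y1 y2 y3 + H z1 z2 z3) / 2 + ((y1 + z1) / 2) ^+ 2 * a.
Hypothesis Hterm : forall x1 x2 x3, x1 ^+ 2 <= x2 -> m <= x3 <= M -> H x1 x2 x3 <= x2 * x3.

Lemma le_functional bl c br d x1 x2 x3 phi
    (mu : {measure set (measurableTypeR R) -> \bar R}) al : c < d ->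
  admissible (itv bl c br d) x1 x2 x3 m M phi mu al ->
  ((H x1 x2 x3)%:E <= functional (itv bl c br d) phi mu al)%E.
Proof.
move=> cd adm; set I := itv bl c br d.
have M0 : 0 < M by exact: le_lt_trans mM.
have l0 : 0 < len I := len_gt0 bl _ br _ cd.
have mI := measurable_itvR bl c br d.
rewrite /functional lee_pdivlMl// -EFinM.
have al0 := adm_alpha_ge0 adm.
have mass := adm_massE cd adm.
have es0 J : dyadic I J -> (0 <= \esum_(K in dyadic J) (al K)%:E)%E.
  by move=> h; apply: esum_ge0 => K hK; rewrite lee_fin al0//; exact: dyadic_trans hK.
have dom J : dyadic I J -> (mu [set` J] <= (M * len J)%:E)%E.
  move=> h; have /andP[_] := adm_carleson adm h; apply: le_trans.
  by rewrite leeDl// es0.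
have esfin : (\esum_(K in dyadic I) (al K)%:E < +oo)%E.
  apply: le_lt_trans (ltry (x3 * len I)); rewrite -mass leeDr//.
have mphi2 : measurable_fun [set` I] (fun t => (phi t ^+ 2)%:E).
  by apply/measurable_EFinP/measurable_funX; exact: (adm_meas adm).
apply/lee_addgt0Pr => eta eta0.
(* The four errors are [M * e] from [k] against [mu], [M * e] from [k] against Lebesgue measure,
   [e * (M * len I)] from the oscillation and [e] from the tail. *)
pose C := 2 * M + M * len I + 1.
have C0 : 0 < C by rewrite /C !addr_gt0// !mulr_gt0.
have [e e0 eC] : exists2 e, 0 < e & e * C = eta.
  by exists (eta / C); [rewrite divr_gt0|rewrite divfK// lt0r_neq0].
have f2 := adm_sqr_int adm.
(* [phi ^+ 2] is approximated in the mean for Lebesgue measure; [mu_k] below transfers the error to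
   [mu]. *)
have [gs [cgs igs]] := approximation_continuous_integrable mI (leb_itv_fin bl c br d) f2.
move=> /fine_cvgP[fin_gs] /cvgr_lt/(_ e e0) hgs.
have [n [finn lene]] : exists n, (\int[leb]_(z in [set` I]) `|(phi z ^+ 2 - gs n z)%:E|)%E \is a fin_num
  /\ fine (\int[leb]_(z in [set` I]) `|(phi z ^+ 2 - gs n z)%:E|)%E < e.
  have [N _ hN] := filterI fin_gs hgs; exists N; exact: (hN N (leqnn N)).
(* Since [phi ^+ 2] is non-negative, taking the modulus of [gs n] does not enlarge the error. *)
pose g t := `|gs n t|; pose k t := `|phi t ^+ 2 - g t|.
have cg : continuous g by move=> t; apply: continuous_comp; [exact: cgs|exact: norm_continuous].
have g0 t : 0 <= g t by exact: normr_ge0.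
have k0 t : 0 <= k t by exact: normr_ge0.
have ig : leb.-integrable [set` I] (EFin \o g) by exact: integrable_norm (igs n).
have ik : leb.-integrable [set` I] (EFin \o k).
  have : leb.-integrable [set` I] (EFin \o (fun t => phi t ^+ 2 - g t)).
    by apply: eq_integrable (integrableB mI f2 ig).
  by move=> /integrable_norm.
have mk : measurable_fun [set` I] (fun t => (k t)%:E) by case/integrableP: ik.
have ke : (\int[leb]_(t in [set` I]) (k t)%:E <= e%:E)%E.
  apply: (@le_trans _ _ (\int[leb]_(z in [set` I]) `|(phi z ^+ 2 - gs n z)%:E|)%E).
    apply: ge0_le_integral => //.
    - by move=> t _; rewrite lee_fin.
    - have : leb.-integrable [set` I] (EFin \o (fun t => phi t ^+ 2 - gs n t)).
        by apply: eq_integrable (integrableB mI f2 (igs n)).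
      by move=> h; case/integrableP: (integrable_abse h).
    - move=> t _; rewrite lee_fin; have := ler_dist_dist (phi t ^+ 2) (gs n t).
      by rewrite (ger0_norm (sqr_ge0 _)).
  by rewrite -(fineK finn) lee_fin ltW.
have [c0 _ hc0] := EVT_max (ltW cd) (continuous_subspaceT cg).
have [r1 r10 hr1] := segment_unif_continuous g c d e cg e0.
(* Adding 1 to the maximum makes [G] positive, so that the tail can be asked to stay below
   [e / G]. *)
pose G := g c0 + 1; have G0 : 0 < G by rewrite ltr_wpDl.
have [r2 r20 hr2] := tail_mass_cvg al bl c br d (e / G) cd al0 esfin (divr_gt0 e0 G0).
pose r := Num.min r1 r2; have r0 : 0 < r by rewrite lt_min r10.
have [N hN] := geometric_small _ 2^-1 (len I) r ltac:(apply/andP; split; lra) r0.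
rewrite exprVn ler_pdivrMl ?exprn_gt0// in hN.
have Icd t : t \in I -> t \in `[c, d].
  by rewrite !in_itv/=; case: (bl); case: (br) => /andP[? ?]; apply/andP; split=> //; exact: ltW.
have gG t : t \in I -> g t <= G by move=> /Icd /hc0 h; rewrite /G; lra.
have hgk t : t \in I -> phi t ^+ 2 <= g t + k t by rewrite -lerBlDl /k ler_norm.
have ghk t : t \in I -> g t <= phi t ^+ 2 + k t by rewrite -lerBlDl /k distrC ler_norm.
have osc s t : s \in I -> t \in I -> `|s - t| <= r -> g s <= g t + e.
  move=> _ /Icd tcd st.
  have : `|g s - g t| <= e by apply: hr1 => //; apply: le_trans st _; rewrite ge_min lexx.
  by rewrite ler_norml => /andP[_]; lra.
have := descent m M phi mu al H Hmain Hterm m0 I g k G e r (ltW e0) g0 k0 ig ik gG hgk ghk osc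
  N bl c br d x1 x2 x3 cd (@subset_refl _ _) adm hN (ltW G0).
move=> hd; apply: le_trans hd _.
rewrite -/I addeC -addeA; set V := (\esum_(J in _) _)%E.
have V0 : (0 <= V)%E.
  by apply: esum_ge0 => K hK; rewrite lee_fin mulr_ge0 ?exprn_ge0// al0.
under [X in (_ <= X + _ + _)%E]eq_integral do rewrite real_normK ?num_real//.
have mu_k : (\int[mu]_(t in [set` I]) (k t)%:E <= (M * e)%:E)%E.
  have := ge0_integral_dominated M mu bl c br d (fun t => (k t)%:E) M0 cd dom _ mk.
  move=> h; apply: le_trans (h _) _; first by move=> t; rewrite lee_fin.
  by rewrite EFinM lee_pmul2l.
have h1 : (\int[mu]_(t in [set` I]) (phi t ^+ 2 + k t + e)%:E <=
    \int[mu]_(t in [set` I]) (phi t ^+ 2)%:E + (M * e + e * (M * len I))%:E)%E.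
  under eq_integral do rewrite EFinD EFinD.
  have E1 : (\int[mu]_(t in [set` I]) ((phi t ^+ 2)%:E + (k t)%:E + e%:E) =
      \int[mu]_(t in [set` I]) (phi t ^+ 2)%:E + \int[mu]_(t in [set` I]) (k t)%:E +
      \int[mu]_(t in [set` I]) e%:E)%E.
    rewrite ge0_integralD//.
    - by rewrite ge0_integralD// => t _; rewrite lee_fin; first exact: sqr_ge0.
    - by move=> t _; apply: adde_ge0; rewrite lee_fin ?sqr_ge0.
    - exact: emeasurable_funD.
    - by move=> t _; rewrite lee_fin ltW.
  rewrite E1.
  rewrite -addeA; apply: leeD => //; rewrite EFinD; apply: leeD => //.
  rewrite integral_cst// EFinM lee_pmul2l//; exact/dom/dyadic_self.
have h2 : (M%:E * \int[leb]_(t in [set` I]) (k t)%:E <= (M * e)%:E)%E.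
  by rewrite EFinM lee_pmul2l.
have h3 : (G%:E * tail_mass al r I <= e%:E)%E.
  rewrite -lee_pdivlMl// -EFinM mulrC; apply: hr2.
  by rewrite ge_min lexx orbT.
rewrite addeA; apply: (le_trans (leeD2r V (leeD (leeD h1 h2) h3))).
rewrite [leRHS]addeAC; apply: leeD => //.
rewrite -2!addeA; apply: leeD => //; rewrite -!EFinD lee_fin -eC /C.
by rewrite le_eqVlt; apply/orP; left; apply/eqP; ring.
Qed.

End LowerBound.
End Limit.

(** * The minorants and the cubic equation *)

Section Minorant.
Context {R : realType}.
Variables m M b : R.
Hypotheses (m0 : 0 <= m) (mM : m < M) (b0 : 0 < b).

(* The supremum over [y] of the affine functions [tangent y] below. *)
Definition minorant (x1 x2 x3 : R) : R :=
  m * x2 + (M - m) ^+ 2 * x1 ^+ 2 / (b * (M - m + b * (M - x3)))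
  - (M - m) * x2 / (b * (1 + b)).

Let tangent y (x1 x2 x3 : R) : R :=
  m * x2 + y ^+ 2 * (x3 - m)
  - (M - m) * (x2 - 2 * (1 + b) * y * x1 + (1 + b) ^+ 2 * y ^+ 2) / (b * (1 + b)).

(** Completing the square in [y]: the defect vanishes exactly at the optimal [y]. *)
Let minorant_tangent y x1 x2 x3 : x3 <= M ->
  minorant x1 x2 x3 = tangent y x1 x2 x3 +
    (((M - m) + b * (M - x3)) * y - (M - m) * x1) ^+ 2 / (b * (M - m + b * (M - x3))).
Proof.
move=> xM; move: m0 mM b0 => m0' mM' b0'.
have E0 : 0 <= b * (M - x3) by rewrite mulr_ge0//; lra.
rewrite /minorant /tangent; field.
by apply/and3P; split; apply: lt0r_neq0; lra.
Qed.

Lemma minorant_main y1 y2 y3 z1 z2 z3 a :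
  y1 ^+ 2 <= y2 -> m <= y3 <= M -> z1 ^+ 2 <= z2 -> m <= z3 <= M -> 0 <= a ->
  (y3 + z3) / 2 + a <= M ->
  minorant ((y1 + z1) / 2) ((y2 + z2) / 2) ((y3 + z3) / 2 + a) <=
    (minorant y1 y2 y3 + minorant z1 z2 z3) / 2 + ((y1 + z1) / 2) ^+ 2 * a.
Proof.
move=> _ /andP[_ yM] _ /andP[_ zM] a0; set x1 := (y1 + z1) / 2; set x3 := _ + a => xM.
move: m0 mM b0 => m0' mM' b0'.
have E0 x : x <= M -> 0 < M - m + b * (M - x).
  by move=> h; have : 0 <= b * (M - x) by [rewrite mulr_ge0//; lra]; lra.
(* The maximiser for the point on the left: [tangent y] is exact there and a lower bound at the two
   other points. *)
pose y := (M - m) * x1 / (M - m + b * (M - x3)).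
have yE : (M - m + b * (M - x3)) * y = (M - m) * x1.
  by rewrite /y mulrC divfK// lt0r_neq0// E0.
have yx : y ^+ 2 <= x1 ^+ 2.
  have q0 : 0 <= (M - m) / (M - m + b * (M - x3)).
    by apply: divr_ge0; [lra|exact: ltW (E0 _ xM)].
  have q1 : (M - m) / (M - m + b * (M - x3)) <= 1.
    by rewrite ler_pdivrMr ?E0// mul1r lerDl mulr_ge0//; lra.
  by rewrite /y mulrAC exprMn ler_piMl ?sqr_ge0// expr_le1.
have sq x u : x <= M -> 0 <= u ^+ 2 / (b * (M - m + b * (M - x))).
  by move=> h; rewrite divr_ge0 ?sqr_ge0// mulr_ge0// ltW// E0.
rewrite (minorant_tangent y _ _ _ xM) yE subrr expr0n/= mul0r addr0.
rewrite (minorant_tangent y _ _ _ yM) (minorant_tangent y _ _ _ zM).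
have h1 := sq _ ((M - m + b * (M - y3)) * y - (M - m) * y1) yM.
have h2 := sq _ ((M - m + b * (M - z3)) * y - (M - m) * z1) zM.
have h3 := ler_wpM2r a0 yx.
have -> : tangent y x1 ((y2 + z2) / 2) x3 =
    (tangent y y1 y2 y3 + tangent y z1 z2 z3) / 2 + y ^+ 2 * a.
  by rewrite /tangent /x1 /x3; field; apply/andP; split; apply: lt0r_neq0; lra.
by lra.
Qed.

(** Replacing [x1 ^+ 2] by [x2] reduces the claim to the parabola, where what remains beyond
    [m * x2] is [x2 * (x3 - m)] times a factor at most 1. *)
Lemma minorant_term x1 x2 x3 : x1 ^+ 2 <= x2 -> m <= x3 <= M -> minorant x1 x2 x3 <= x2 * x3.
Proof.
move=> h12 /andP[mx xM]; move: m0 mM b0 => m0' mM' b0'.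
have h : 0 <= b * (M - x3) by rewrite mulr_ge0//; lra.
have E0 : 0 < M - m + b * (M - x3) by lra.
have b1 : 0 < b * (1 + b) by rewrite mulr_gt0//; lra.
have x20 : 0 <= x2 by apply: le_trans h12; exact: sqr_ge0.
have h1 : (M - m) ^+ 2 * x1 ^+ 2 / (b * (M - m + b * (M - x3))) <=
    (M - m) ^+ 2 * x2 / (b * (M - m + b * (M - x3))).
  by rewrite ler_pM2r ?invr_gt0 ?mulr_gt0// ler_wpM2l ?sqr_ge0.
have h2 : (M - m) ^+ 2 * x2 / (b * (M - m + b * (M - x3))) - (M - m) * x2 / (b * (1 + b)) =
    x2 * (x3 - m) * ((M - m) / ((M - m + b * (M - x3)) * (1 + b))).
  by field; apply/and3P; split; apply: lt0r_neq0; lra.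
have h3 : (M - m) / ((M - m + b * (M - x3)) * (1 + b)) <= 1.
  rewrite ler_pdivrMr ?mul1r; last by rewrite mulr_gt0//; lra.
  by have := mulr_ge0 (ltW E0) (ltW b0'); lra.
have h4 : 0 <= x2 * (x3 - m) by rewrite mulr_ge0//; lra.
have := ler_wpM2l h4 h3; rewrite /minorant; lra.
Qed.

End Minorant.

(** * Existence and uniqueness of the root of the cubic *)

Section CubicRoot.
Context {R : realType}.
Variables r C : R.
Hypotheses (C0 : 0 <= C) (Cr : C < r) (r1 : r < 1).

(** The cubic equation with its denominators cleared, in the variable [b = -2 a (M - m)], where [r]
    is [x1^2 / x2] and [C] is [(M - x3) / (M - m)]. *)
Definition cubic (b : R) := (1 + b * C) ^+ 2 * (1 + 2 * b) - r * (1 + b) ^+ 2 * (1 + 2 * b * C).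

(* [cubic b / b ^+ 2] is decreasing on the positive half-line. *)
Lemma cubic_root_unique b1 b2 : 0 < b1 -> 0 < b2 -> cubic b1 = 0 -> cubic b2 = 0 -> b1 = b2.
Proof.
wlog le : b1 b2 / b1 <= b2.
  by move=> h p1 p2 e1 e2; have [/h|/ltW/h] := leP b1 b2; [exact|move=> /(_ p2 p1 e2 e1)].
move=> p1 p2 e1 e2; apply/eqP; move: le; rewrite le_eqVlt => /orP[//|lt]; exfalso.
move: C0 Cr r1 => C0' Cr' r1'.
have : b2 ^+ 2 * cubic b1 - b1 ^+ 2 * cubic b2 = 0 by rewrite e1 e2 !mulr0 subr0.
have -> : b2 ^+ 2 * cubic b1 - b1 ^+ 2 * cubic b2 = (b2 - b1) *
  ((1 - r) * (b2 + b1) + (1 - r) * (2 + 2 * C) * (b1 * b2) + 2 * C * (r - C) * (b1 * b2) ^+ 2).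
  by rewrite /cubic; ring.
apply/eqP/lt0r_neq0; rewrite mulr_gt0 ?subr_gt0//.
have h1 : 0 < (1 - r) * (b2 + b1) by rewrite mulr_gt0//; lra.
have h2 : 0 <= (1 - r) * (2 + 2 * C) * (b1 * b2).
  by rewrite mulr_ge0 ?(ltW (mulr_gt0 p1 p2))// mulr_ge0//; lra.
have h3 : 0 <= 2 * C * (r - C) * (b1 * b2) ^+ 2.
  by rewrite mulr_ge0 ?sqr_ge0// mulr_ge0//; lra.
lra.
Qed.

(** The value at 0 is [1 - r > 0], and the leading coefficient is negative. *)
Lemma cubic_root_exists : exists2 b, 0 < b & cubic b = 0.
Proof.
move: C0 Cr r1 => C0' Cr' r1'.
have [B B0 hB] : exists2 B, 0 < B & cubic B <= 0.
  have r0 : 0 < r by lra.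
  (* For [C = 0] the degree drops to two, with leading coefficient [- r]. *)
  have [C00|Cn0] := eqVneq C 0.
    exists (3 / r + 1); first by rewrite ltr_wpDl// divr_ge0//; lra.
    rewrite /cubic C00 !mulr0 addr0 expr1n mul1r mulr1.
    set B := 3 / r + 1.
    have rB : r * B = 3 + r by rewrite /B mulrDr mulrCA divff ?mulr1// lt0r_neq0.
    have B1 : 1 <= B by rewrite lerDr divr_ge0//; lra.
    have -> : 1 + 2 * B - r * (1 + B) ^+ 2 = 1 + 2 * B - r - 2 * (r * B) - (r * B) * B by ring.
    rewrite rB; have := mulr_ge0 (ltW r0) (le_trans ler01 B1); lra.
  have Cp : 0 < C by rewrite lt0r Cn0.
  pose K := 2 * C * (r - C); have K0 : 0 < K by rewrite mulr_gt0//; lra.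
  (* [- K] is the leading coefficient; the other terms add up to at most [9 * B ^+ 2]. *)
  pose B := 9 / K + 1.
  have B1 : 1 <= B by rewrite lerDr divr_ge0//; lra.
  have KB : K * B = 9 + K by rewrite /B mulrDr mulrCA divff ?mulr1// lt0r_neq0.
  exists B; first by lra.
  have -> : cubic B = (1 - r) + (1 - r) * (2 + 2 * C) * B +
      (4 * C * (1 - r) - (r - C ^+ 2)) * B ^+ 2 - (K * B) * B ^+ 2.
    by rewrite /cubic /K; ring.
  have BB : B <= B ^+ 2 by rewrite expr2 ler_peMl//; lra.
  have h1 : (1 - r) * (2 + 2 * C) <= 4.
    have : (1 - r) * (2 + 2 * C) <= 1 * 4 by rewrite ler_pM//; lra.
    by rewrite mul1r.
  have h2 : (1 - r) * (2 + 2 * C) * B <= 4 * B ^+ 2.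
    by apply: le_trans (ler_wpM2l _ BB) _; rewrite ?ler_wpM2r ?mulr_ge0//; lra.
  have h3 : C * (1 - r) <= 1.
    have : C * (1 - r) <= 1 * 1 by rewrite ler_pM//; lra.
    by rewrite mul1r.
  have CC : C ^+ 2 <= C by rewrite expr2 ler_piMl//; lra.
  have h4 : (4 * C * (1 - r) - (r - C ^+ 2)) * B ^+ 2 <= 4 * B ^+ 2.
    by rewrite ler_wpM2r ?sqr_ge0//; lra.
  rewrite KB mulrDl; have := mulr_ge0 (ltW K0) (sqr_ge0 B); lra.
pose p : {poly R} := (r *: (1 + 'X) ^+ 2 * (1 + (2 * C) *: 'X)) - (1 + C *: 'X) ^+ 2 * (1 + 2 *: 'X).
have pE x : p.[x] = - cubic x by rewrite /p /cubic !hornerE; ring.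
have [|b hb /rootP pb] := poly_ivt (p := p) (ltW B0).
  by rewrite !pE oppr_ge0 hB andbT /cubic; lra.
have cb : cubic b = 0 by apply/eqP; rewrite -oppr_eq0 -pE pb.
exists b => //; case/andP: hb; rewrite le_eqVlt => /orP[/eqP b00|//].
move: cb; rewrite -b00 /cubic; lra.
Qed.

End CubicRoot.

(** * Comparison of both bounds with the explicit formula *)

Section BellmanValue.
Context {R : realType}.
Variables (m M x1 x2 x3 : R).
Hypotheses (m0 : 0 <= m) (mM : m < M) (x20 : 0 < x2) (x12 : x1 ^+ 2 <= x2).
Hypotheses (mx : m <= x3) (xM : x3 <= M).

Let r := x1 ^+ 2 / x2.
Let C := (M - x3) / (M - m).

Lemma cubic_eqE a : a < 0 ->
  cubic_eq x1 x2 x3 m M a <-> cubic (x1 ^+ 2 / x2) ((M - x3) / (M - m)) (- 2 * a * (M - m)) = 0.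
Proof.
move=> a0; move: mM mx xM => mM' mx' xM'.
have aM : 0 < - a * (M - m) by rewrite mulr_gt0//; lra.
have ax : 0 <= - a * (M - x3) by rewrite mulr_ge0//; lra.
have D0 : M - m != 0 by apply: lt0r_neq0; lra.
have bC : - 2 * a * (M - m) * ((M - x3) / (M - m)) = - 2 * a * (M - x3) by field.
have -> : cubic (x1 ^+ 2 / x2) ((M - x3) / (M - m)) (- 2 * a * (M - m)) =
  (1 - 2 * a * (M - x3)) ^+ 2 * (1 - 4 * a * (M - m)) -
    x1 ^+ 2 / x2 * ((1 - 2 * a * (M - m)) ^+ 2 * (1 - 4 * a * (M - x3))).
  by rewrite /cubic -[2 * (- 2 * a * (M - m)) * _]mulrA bC; ring.
have P1 : 1 - 2 * a * (M - m) != 0 by apply: lt0r_neq0; lra.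
have P2 : 1 - 4 * a * (M - x3) != 0 by apply: lt0r_neq0; lra.
have P3 : (1 - 2 * a * (M - m)) ^+ 2 * (1 - 4 * a * (M - x3)) != 0.
  by rewrite mulf_neq0// expf_neq0.
rewrite /cubic_eq expr_div_n mulf_div; split=> [->|/eqP].
  by rewrite divfK// subrr.
by rewrite subr_eq0 => /eqP ->; rewrite mulfK.
Qed.

Section Curved.
Hypotheses (lt12 : x1 ^+ 2 < x2) (hx3 : M - (M - m) * (x1 ^+ 2 / x2) < x3).

Let D0 : 0 < M - m. Proof. by rewrite subr_gt0. Qed.

Let C0 : 0 <= C. Proof. by rewrite /C divr_ge0 ?(ltW D0)// subr_ge0. Qed.

Let Cr : C < r.
Proof. by rewrite /C /r ltr_pdivrMr//; move: hx3 => h; lra. Qed.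

Let r1 : r < 1. Proof. by rewrite /r ltr_pdivrMr// mul1r. Qed.

Lemma cubic_eq_unique : exists! a, a < 0 /\ cubic_eq x1 x2 x3 m M a.
Proof.
have [b b0 cb] := cubic_root_exists r C C0 Cr r1.
have Dn := lt0r_neq0 D0.
have bE : - 2 * (- b / (2 * (M - m))) * (M - m) = b by field.
have a0 : - b / (2 * (M - m)) < 0 by rewrite mulNr oppr_lt0 divr_gt0// mulr_gt0.
exists (- b / (2 * (M - m))); split.
  by split=> //; apply/cubic_eqE => //; rewrite bE.
move=> a [an /(cubic_eqE _ an) ca].
have bp : 0 < - 2 * a * (M - m) by rewrite mulr_gt0//; lra.
have := cubic_root_unique r C C0 Cr r1 _ _ b0 bp cb ca => ->.
by field.
Qed.

Let a_minusP : a_minus x1 x2 x3 m M < 0 /\ cubic_eq x1 x2 x3 m M (a_minus x1 x2 x3 m M).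
Proof.
rewrite /a_minus lt_eqF//.
have [a [h _]] := cubic_eq_unique; exact: (@xgetPex _ 0 [set a | a < 0 /\ cubic_eq x1 x2 x3 m M a] (ex_intro _ a h)).
Qed.

Let b := - 2 * a_minus x1 x2 x3 m M * (M - m).

Let b0 : 0 < b.
Proof. by rewrite /b mulr_gt0//; have [h _] := a_minusP; lra. Qed.

Let rE : r = (1 + b * C) ^+ 2 * (1 + 2 * b) / ((1 + b) ^+ 2 * (1 + 2 * b * C)).
Proof.
have [an /(cubic_eqE _ an)] := a_minusP; rewrite -/r -/C -/b /cubic => /eqP.
rewrite subr_eq0 => /eqP ->; have bC := mulr_ge0 (ltW b0) C0; move: b0 => b0'.
by field; apply/andP; split; apply: lt0r_neq0; lra.
Qed.

Let BformulaE : Bformula x1 x2 x3 m M =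
  (x3 - m) * x2 / ((1 + b) ^+ 2 * (1 + 2 * b * C)) + m * x2.
Proof.
rewrite /Bformula; congr (_ / (_ ^+ 2 * _) + _); first by rewrite /b; ring.
by rewrite /b /C; field; exact: lt0r_neq0.
Qed.

Let x1E : x1 ^+ 2 = r * x2. Proof. by rewrite /r divfK// lt0r_neq0. Qed.

Let x3E : x3 = M - (M - m) * C.
Proof. by rewrite /C; field; exact: lt0r_neq0. Qed.

Lemma Bmin_le_Bformula : Bmin_le m M x1 x2 x3 (Bformula x1 x2 x3 m M).
Proof.
have C01 : 0 <= C <= 1 by rewrite C0/= (ltW (lt_trans Cr r1)).
have bC := mulr_ge0 (ltW b0) C0; move: b0 => b0'.
have n1 : 1 + b * C != 0 by apply: lt0r_neq0; lra.
have n2 : 1 + 2 * b != 0 by apply: lt0r_neq0; lra.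
have n3 : 1 + b != 0 by apply: lt0r_neq0; lra.
have n4 : 1 + 2 * b * C != 0 by apply: lt0r_neq0; lra.
(* This [u] matches the first coordinate; the cubic equation, in the form [rE], then matches the
   second. *)
have := Bmin_le_upper m M m0 mM b b0 (x1 * (1 + b) / (1 + b * C)) x3 C C01 x3E.
have u2 : (x1 * (1 + b) / (1 + b * C)) ^+ 2 = x2 * (1 + 2 * b) / (1 + 2 * b * C).
  by rewrite expr_div_n exprMn x1E rE; field; rewrite n1 n3 n4.
rewrite u2 BformulaE; congr Bmin_le.
- by field; rewrite n1 n3.
- by field; rewrite n2 n4.
- by field; rewrite n2 n3 n4.
Qed.

(** The root [b] used in the upper bound also serves here: once [x1 ^+ 2] and [x3] are expressed
    through [b] and [C], a rational identity remains. *)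
Lemma minorant_Bformula : minorant m M b x1 x2 x3 = Bformula x1 x2 x3 m M.
Proof.
have bC := mulr_ge0 (ltW b0) C0; have Cle := C0; move: b0 D0 => b0' D0'.
have e : M - m + b * (M - x3) = (M - m) * (1 + b * C).
  by rewrite x3E; ring.
rewrite BformulaE /minorant e x1E rE {1}x3E.
by field; rewrite !lt0r_neq0//; lra.
Qed.

Lemma minorant_Bformula_ex : exists2 b, 0 < b & minorant m M b x1 x2 x3 = Bformula x1 x2 x3 m M.
Proof. by exists b => //; exact: minorant_Bformula. Qed.

End Curved.

(** On the parabola [a = 0], which corresponds to [b] tending to 0; the loss at a given [b] is at
    most [2 * k * b]. *)
Lemma minorant_parabola e : x1 ^+ 2 = x2 -> 0 < e ->
  exists2 b, 0 < b & x2 * x3 <= minorant m M b x1 x2 x3 + e.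
Proof.
move=> eq12 e0; move: m0 mM mx xM x20 => m0' mM' mx' xM' x20'.
pose k := x2 * (x3 - m).
have k0 : 0 <= k by rewrite mulr_ge0//; lra.
pose b := e / (2 * k + 1).
have b0 : 0 < b by rewrite divr_gt0//; lra.
exists b => //; rewrite /minorant eq12.
have bx : 0 <= b * (M - x3) by rewrite mulr_ge0//; lra.
have -> : m * x2 + (M - m) ^+ 2 * x2 / (b * (M - m + b * (M - x3))) - (M - m) * x2 / (b * (1 + b)) =
   m * x2 + k * ((M - m) / ((M - m + b * (M - x3)) * (1 + b))).
  by rewrite /k; field; apply/and3P; split; apply: lt0r_neq0; lra.
have h1 : 1 - 2 * b <= (M - m) / ((M - m + b * (M - x3)) * (1 + b)).
  have bM : b * (M - x3) <= b * (M - m) by rewrite ler_pM2l//; lra.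
  rewrite ler_pdivlMr; last by rewrite mulr_gt0//; lra.
  (* A non-positive left side is trivial. Otherwise [M - x3] may be enlarged to [M - m]. *)
  have [hb|hb] := leP (1 - 2 * b) 0.
    by apply: (@le_trans _ _ 0); [rewrite mulr_le0_ge0// mulr_ge0//; lra|lra].
  apply: (@le_trans _ _ ((1 - 2 * b) * ((M - m) * (1 + b) * (1 + b)))).
    by rewrite ler_pM2l// ler_pM2r; lra.
  rewrite (_ : (1 - 2 * b) * _ = (M - m) * (1 - b ^+ 2 * (3 + 2 * b))); last by ring.
  rewrite ler_piMr ?(ltW (_ : 0 < M - m))//; first lra.
  by rewrite gerBl mulr_ge0 ?sqr_ge0//; lra.
have h2 : 2 * k * b <= e.
  by rewrite /b mulrCA ler_piMr ?(ltW e0)// ler_pdivrMr; lra.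
have := ler_wpM2l k0 h1; rewrite /k in h2 *; lra.
Qed.

End BellmanValue.

Theorem theorem4 (R : realType) (m M : R) (hm : 0 <= m) (hmM : m < M)
    (bl br : bool) (c d : R) (hcd : c < d)
    (x1 x2 x3 : R) (hx2 : 0 < x2) (hx12 : x1 ^+ 2 <= x2)
    (hx3 : m <= x3 <= M) :
  (x1 ^+ 2 < x2 -> M - (M - m) * (x1 ^+ 2 / x2) < x3 ->
     exists! a : R, a < 0 /\ cubic_eq x1 x2 x3 m M a) /\
  Bmin (Interval (BSide bl c) (BSide br d)) x1 x2 x3 m M =
    (if M - (M - m) * (x1 ^+ 2 / x2) < x3
     then Bformula x1 x2 x3 m M else m * x2)%:E.
Proof.
have /andP[mx xM] := hx3; split.
  by move=> h12 h3; exact: cubic_eq_unique.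
have Bge b : 0 < b -> ((minorant m M b x1 x2 x3)%:E <= Bmin (itv bl c br d) x1 x2 x3 m M)%E.
  move=> b0; apply: le_ereal_inf_tmp => _ [phi [mu [al [adm ->]]]].
  apply: (le_functional m M (minorant m M b)) adm => //.
    exact: minorant_main.
  exact: minorant_term.
apply/eqP; rewrite eq_le; apply/andP; split.
  apply: (_ : Bmin_le m M x1 x2 x3 _) => //.
  case: ifPn => [h3|]; last first.
    by rewrite -leNgt => h3; exact: Bmin_le_flat.
  have [h12|h12] := ltP (x1 ^+ 2) x2; first exact: Bmin_le_Bformula.
  have e12 : x1 ^+ 2 = x2 by apply/eqP; rewrite eq_le hx12.
  (* On the parabola [a_minus] is 0, and the formula reduces to [x2 * x3]. *)
  have := Bmin_le_crude m M hm x1 x2 x3 hx12 hx3; congr Bmin_le.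
  by rewrite /Bformula /a_minus e12 eqxx; field.
case: ifPn => [h3|_].
  have [h12|h12] := ltP (x1 ^+ 2) x2.
    have [b b0 <-] := minorant_Bformula_ex m M x1 x2 x3 hmM hx2 mx xM h12 h3.
    exact: Bge.
  have e12 : x1 ^+ 2 = x2 by apply/eqP; rewrite eq_le hx12.
  rewrite (_ : Bformula x1 x2 x3 m M = x2 * x3); last first.
    by rewrite /Bformula /a_minus e12 eqxx; field.
  apply/lee_addgt0Pr => e e0.
  have [b b0 hb] := minorant_parabola m M x1 x2 x3 hm hmM hx2 mx xM e e12 e0.
  by apply: le_trans (leeD2r _ (Bge _ b0)); rewrite -EFinD lee_fin.
apply: le_ereal_inf_tmp => _ [phi [mu [al [adm ->]]]].
(* Below the threshold [m * x2] is itself a subsolution: it is linear and does not depend on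
   [x3]. *)
apply: (le_functional m M (fun _ y _ => m * y)) adm => //.
- move=> y1 y2 y3 z1 z2 z3 a _ _ _ _ a0 _.
  by have := mulr_ge0 (sqr_ge0 ((y1 + z1) / 2)) a0; lra.
- move=> y1 y2 y3 hy /andP[my _]; rewrite mulrC ler_wpM2l//.
  by apply: le_trans hy; exact: sqr_ge0.
Qed.
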